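(* An infinite word $\alpha$ is determined by some indexed language if and only if $\alpha$ is morphic.
   Context: Indexed languages are the languages generated by indexed grammars (Aho's grammars in which nonterminals carry stacks that can be pushed, popped and copied). A language $L$ determines an infinite word $\alpha$ iff $L$ is infinite and every $x\in L$ is a prefix of $\alpha$. A morphism $h$ on an alphabet $A$ is a map $A^*\to A^*$ with $h(xy)=h(x)h(y)$; it is a coding if $|h(a)|=1$ for all $a\in A$. A string $x$ is mortal for $h$ if $h^m(x)$ is empty for some $m\ge0$. $h$ is prolongable on $a\in A$ if $h(a)=ax$ with $x$ not mortal; then $h^\omega(a)$ denotes the infinite word $a\,x\,h(x)\,h^2(x)\cdots$. An infinite word $\alpha$ is morphic if there are a morphism $h$, a coding $e$ and a symbol $a$ with $h$ prolongable on $a$ and $\alpha=e(h^\omega(a))$. *)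

(* Defs.v *)
From Stdlib Require Import Relations List.
From mathcomp Require Import all_boot.
Set Implicit Arguments. Unset Strict Implicit. Unset Printing Implicit Defensive.

(* Right-hand sides of ordinary productions: elements of (N F* u T)*.
   [NT X psi] is the nonterminal X followed by the flag string psi
   (first element of psi = leftmost flag = top of stack). *)
Inductive rhs_sym (N F A : Type) :=
| RTerm of A
| RNT of N & seq F.

Record indexed_grammar (A : finType) := IndexedGrammar {
  ig_N : finType;
  ig_F : finType;
  ig_start : ig_N;
  ig_prods : seq (ig_N * seq (rhs_sym ig_N ig_F A));
  ig_flag_prods : seq (ig_F * ig_N * seq (ig_N + A))  (* (f, A, alpha): A -> alpha in flag f, alpha in (N u T)* *)
}.

Definition sform (A : finType) (G : indexed_grammar A) :=
  seq (A + (ig_N G * seq (ig_F G)))%type.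

Definition inst_prod (A : finType) (G : indexed_grammar A) (xi : seq (ig_F G))
  (s : rhs_sym (ig_N G) (ig_F G) A) : A + (ig_N G * seq (ig_F G)) :=
  match s with
  | RTerm a => inl a
  | RNT Y psi => inr (Y, psi ++ xi)
  end.

Definition inst_flag (A : finType) (G : indexed_grammar A) (xi : seq (ig_F G))
  (s : ig_N G + A) : A + (ig_N G * seq (ig_F G)) :=
  match s with
  | inl Y => inr (Y, xi)
  | inr a => inl a
  end.

Definition ig_step (A : finType) (G : indexed_grammar A) (u v : sform G) : Prop :=
  exists (pre post : sform G) (X : ig_N G) (xi : seq (ig_F G)),
    u = pre ++ inr (X, xi) :: post /\
    ( (exists rhs, List.In (X, rhs) (ig_prods G) /\
                   v = pre ++ map (@inst_prod A G xi) rhs ++ post)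
    \/ (exists f xi' rhs, xi = f :: xi' /\ List.In (f, X, rhs) (ig_flag_prods G) /\
                   v = pre ++ map (@inst_flag A G xi') rhs ++ post)).

Definition ig_derives (A : finType) (G : indexed_grammar A) : relation (sform G) :=
  clos_refl_trans (sform G) (@ig_step A G).

Definition ig_lang (A : finType) (G : indexed_grammar A) (w : seq A) : Prop :=
  @ig_derives A G [:: inr (ig_start G, [::])] (map inl w).

Definition indexed_language (A : finType) (L : seq A -> Prop) : Prop :=
  exists G : indexed_grammar A, forall w, L w <-> ig_lang G w.

Definition is_prefix (A : Type) (x : seq A) (alpha : nat -> A) : Prop :=
  forall i (d : A), i < size x -> nth d x i = alpha i.

Definition lang_infinite (A : Type) (L : seq A -> Prop) : Prop :=
  ~ (exists l : seq (seq A), forall w, L w -> List.In w l).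

Definition determines (A : Type) (L : seq A -> Prop) (alpha : nat -> A) : Prop :=
  lang_infinite L /\ forall x, L x -> is_prefix x alpha.

Definition morph_ext (B : Type) (h : B -> seq B) (x : seq B) : seq B :=
  flatten (map h x).

Definition mortal (B : Type) (h : B -> seq B) (x : seq B) : Prop :=
  exists m, iter m (morph_ext h) x = [::].

Definition prolongable (B : Type) (h : B -> seq B) (a : B) : Prop :=
  exists x, h a = a :: x /\ ~ mortal h x.

(* beta = h^omega(a): every h^n(a) is a prefix of beta (under prolongability the
   lengths of h^n(a) are unbounded, so this pins beta down uniquely). *)
Definition is_h_omega (B : Type) (h : B -> seq B) (a : B) (beta : nat -> B) : Prop :=
  forall n, is_prefix (iter n (morph_ext h) [:: a]) beta.

Definition morphic (A : Type) (alpha : nat -> A) : Prop :=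
  exists (B : finType) (h : B -> seq B) (e : B -> A) (a : B),
    prolongable h a /\
    exists beta : nat -> B, is_h_omega h a beta /\ forall i, alpha i = e (beta i).

(* Main.v *)
Require Import Defs.
From Stdlib Require Import Relations ClassicalEpsilon.
From Stdlib Require List.
From mathcomp Require Import all_boot zify.
Set Implicit Arguments. Unset Strict Implicit. Unset Printing Implicit Defensive.

(** From left to right, the main point is a pumping argument. Attach to every
    stack the sets of nonterminals that can yield some word, respectively some
    nonempty word, on it; this profile of a concatenation [rho ++ sigma] depends
    only on [rho] and the profile of [sigma]. A long word has a derivation tree
    with a path that has many edges with a nonempty sibling. Such a path is a run
    of a pushdown system, hence decomposes along pushes and pops like a
    context-free derivation, whose nonterminals are the quadruples (state, top
    flag, state after popping the flag, profile of the stack below). A quadruple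
    of unbounded weight that is minimal for reachability must be nested in
    itself with a nonempty contribution. Repeating this loop n times yields words
    of the language that are images under a morphism g of words obtained by
    iterating a morphism H, where H and g are nonerasing because letters without
    nonempty yield are dropped. Finally, a word with unboundedly long prefixes
    g(H^n(W)) is morphic: look at the first letter of W with unbounded growth;
    after passing to a power of H, either bounded letters accumulate in front of
    it and the word is ultimately periodic, or that letter is prolongable.

    From right to left, e(h^n(a)) is generated by first pushing n copies of a
    flag and then applying h at each pop. *)

(** * Iterated morphisms *)

Definition subst (B C : Type) (g : B -> seq C) (x : seq B) : seq C :=
  flatten (map g x).

Lemma subst_cat (B C : Type) (g : B -> seq C) x y :
  subst g (x ++ y) = subst g x ++ subst g y.
Proof. by rewrite /subst map_cat flatten_cat. Qed.

Lemma subst_cons (B C : Type) (g : B -> seq C) b y :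
  subst g (b :: y) = g b ++ subst g y.
Proof. by []. Qed.

Lemma subst_seq1 (B C : Type) (g : B -> seq C) b : subst g [:: b] = g b.
Proof. by rewrite /subst /= cats0. Qed.

Lemma subst_pure (B : Type) (x : seq B) : subst (fun b => [:: b]) x = x.
Proof. by elim: x => //= b x IH; rewrite subst_cons IH. Qed.

Lemma subst_map (B C D : Type) (g : C -> seq D) (f : B -> C) x :
  subst g (map f x) = subst (g \o f) x.
Proof. by rewrite /subst -map_comp. Qed.

Lemma eq_subst (B C : Type) (g g' : B -> seq C) x :
  g =1 g' -> subst g x = subst g' x.
Proof. by move=> E; rewrite /subst (eq_map E). Qed.

Lemma map_subst (B C D : Type) (g : B -> seq C) (f : C -> D) x :
  map f (subst g x) = subst (map f \o g) x.
Proof. by rewrite /subst map_flatten -map_comp. Qed.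

Lemma morph_extE (B : Type) (h : B -> seq B) x : morph_ext h x = subst h x.
Proof. by []. Qed.

Lemma subst_neq0 (B C : Type) (g : B -> seq C) x :
  (forall b, g b <> [::]) -> x <> [::] -> subst g x <> [::].
Proof.
move=> gN; case: x => // b x _; rewrite subst_cons => E.
by apply: (gN b); move: E; case: (g b).
Qed.

Lemma size_subst (B C : Type) (g : B -> seq C) x :
  (forall b, g b <> [::]) -> size x <= size (subst g x).
Proof.
move=> gN; elim: x => //= b x IH; rewrite subst_cons size_cat.
by case: (g b) (gN b) => //= c s _; lia.
Qed.

Lemma iter_morph_cat (B : Type) (h : B -> seq B) n x y :
  iter n (morph_ext h) (x ++ y) =
  iter n (morph_ext h) x ++ iter n (morph_ext h) y.
Proof. by elim: n => //= n ->; rewrite morph_extE subst_cat. Qed.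

Lemma iter_morph_nil (B : Type) (h : B -> seq B) n :
  iter n (morph_ext h) [::] = [::].
Proof. by elim: n => //= n ->. Qed.

Lemma iter_morph_neq0 (B : Type) (h : B -> seq B) n x :
  (forall b, h b <> [::]) -> x <> [::] -> iter n (morph_ext h) x <> [::].
Proof. by move=> hN xN; elim: n => //= n IH; apply: subst_neq0. Qed.

Lemma is_prefix_catl (A : Type) (x y : seq A) alpha :
  is_prefix (x ++ y) alpha -> is_prefix x alpha.
Proof.
move=> P i d lti; rewrite -(P i d) ?nth_cat ?lti // size_cat.
exact: leq_trans lti (leq_addr _ _).
Qed.

(** The product [x H(x) ... H^(n-1)(x)]: for a letter [a] with [H(a) = ax], the word [H^n(a)] is [a]
    followed by it. *)
Definition series (B : Type) (H : B -> seq B) (x : seq B) (n : nat) : seq B :=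
  flatten [seq iter i (morph_ext H) x | i <- iota 0 n].

Lemma seriesS (B : Type) (H : B -> seq B) x n :
  series H x n.+1 = series H x n ++ iter n (morph_ext H) x.
Proof. by rewrite /series -[in LHS](addn1 n) iotaD map_cat flatten_cat /= cats0. Qed.

Lemma series_recl (B : Type) (H : B -> seq B) x n :
  series H x n.+1 = x ++ morph_ext H (series H x n).
Proof.
elim: n => [|n IH]; first by rewrite seriesS /= cats0.
by rewrite [in RHS]seriesS seriesS IH -catA !morph_extE subst_cat.
Qed.

Lemma series_shift (B : Type) (H : B -> seq B) x n :
  series H x n.+1 = x ++ series H (morph_ext H x) n.
Proof.
elim: n => [|n IH]; first by rewrite seriesS /= cats0.
by rewrite seriesS IH seriesS iterSr -catA.
Qed.

(** * Infinite words with prefixes [p g(x) g(H(x)) ... g(H^(n-1)(x))] are morphic *)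

Section SeriesMorphic.
Variables (A : Type) (alpha : nat -> A) (B : finType).
Variables (H : B -> seq B) (g : B -> seq A) (p : seq A) (x : seq B).
Hypothesis HN : forall b, H b <> [::].
Hypothesis gN : forall b, g b <> [::].
Hypothesis xN : x <> [::].
Hypothesis pN : p <> [::].
Hypothesis pref : forall n, is_prefix (p ++ subst g (series H x n)) alpha.

(** [None] is a fresh start letter that grows into [None x H(x) H^2(x) ...] under [H'], and [G]
    sends it to [p]. To replace [G] by a coding, each letter [o] becomes a block of as many letters
    as [G o] has, distinguished by their positions. *)
Let G (o : option B) : seq A := if o is Some b then g b else p.
Let H' (o : option B) : seq (option B) :=
  if o is Some b then map Some (H b) else None :: map Some x.
Let bound := \max_(o : option B) size (G o).
Let B' : finType := (option B * 'I_bound.+1)%type.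
Let block (o : option B) : seq B' := [seq (o, inord i) | i <- iota 0 (size (G o))].
(* The first letter of the block of [o] generates the blocks of all letters of
   [H' o], the remaining letters of the block are erased. *)
Let h (c : B') : seq B' := if val c.2 == 0 then subst block (H' c.1) else [::].
Let e (c : B') : A := nth (alpha 0) (G c.1) c.2.
Let a : B' := (None, ord0).

Let GN o : G o <> [::]. Proof. by case: o => [b|] //=; apply: gN. Qed.

Let size_G o : size (G o) < bound.+1.
Proof. by rewrite ltnS /bound (leq_bigmax_cond (F := fun o => size (G o))). Qed.

Let blockE o : block o =
  (o, ord0) :: [seq (o, inord i) | i <- iota 1 (size (G o)).-1].
Proof.
rewrite /block; case: (G o) (@GN o) => //= c s _; congr ((_, _) :: _).
by apply/val_inj; rewrite /= inordK.
Qed.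

Let h_rest o : subst h [seq (o, inord i) | i <- iota 1 (size (G o)).-1] = [::].
Proof.
have : all (fun i => 0 < i < size (G o)) (iota 1 (size (G o)).-1).
  by apply/allP => i; rewrite mem_iota; lia.
elim: (iota 1 _) => //= i s IH /andP[/andP[i0 ilt] /IH {}IH].
rewrite subst_cons IH cats0 /h /= inordK ?(negbTE _) //; first by case: (i) i0.
exact: leq_trans ilt (ltnW (size_G o)).
Qed.

Let h_block o : subst h (block o) = subst block (H' o).
Proof. by rewrite blockE subst_cons h_rest cats0 /h. Qed.

Let h_blocks y : morph_ext h (subst block y) = subst block (subst H' y).
Proof.
rewrite morph_extE; elim: y => //= o y IH.
by rewrite !subst_cons !subst_cat h_block IH.
Qed.

Let e_block o : map e (block o) = G o.
Proof.
rewrite /block -map_comp -[RHS](mkseq_nth (alpha 0)) /mkseq.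
apply/eq_in_map => i; rewrite mem_iota /= => ilt.
by rewrite /e /= inordK //; apply: leq_trans ilt (ltnW (size_G o)).
Qed.

Let e_blocks y : map e (subst block y) = subst G y.
Proof. by rewrite map_subst; apply: eq_subst => o; apply: e_block. Qed.

Let iter_H' n : iter n (morph_ext H') [:: None] = None :: map Some (series H x n).
Proof.
elim: n => //= n ->; rewrite morph_extE subst_cons series_recl map_cat; congr (_ :: _ ++ _).
by rewrite morph_extE map_subst subst_map.
Qed.

(** Exponents start at 1, because [a] alone is only the first letter of the block of [None]. *)
Let words n : iter n.+1 (morph_ext h) [:: a] = subst block (iter n.+1 (morph_ext H') [:: None]).
Proof.
elim: n => [|n IH].
  by rewrite /= !morph_extE !subst_seq1 /h.
by rewrite iterS IH h_blocks.
Qed.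

Let blockN o : block o <> [::]. Proof. by rewrite blockE. Qed.

Let size_word n : n < size (iter n (morph_ext h) [:: a]).
Proof.
case: n => // n; rewrite words; apply: leq_trans (size_subst _ (@blockN)).
rewrite iter_H' /= size_map ltnS; elim: n.+1 => // m IH.
rewrite seriesS size_cat.
by case: (iter m _ x) (iter_morph_neq0 (n := m) HN xN) => //= c s _; lia.
Qed.

Let step : exists y, h a = a :: y /\ ~ mortal h y.
Proof.
rewrite {1}/h /= subst_cons blockE /=; eexists; split; first by [].
case=> m; rewrite iter_morph_cat.
have -> : subst block (map Some x) = subst (block \o Some) x by rewrite subst_map.
have E : forall z, morph_ext h (subst (block \o Some) z) = subst (block \o Some) (morph_ext H z).
  by move=> z; rewrite -!subst_map h_blocks subst_map map_subst.
have {}E : iter m (morph_ext h) (subst (block \o Some) x) = subst (block \o Some) (iter m (morph_ext H) x).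
  by elim: m => //= m ->.
rewrite E => /(congr1 size); rewrite size_cat.
have : subst (block \o Some) (iter m (morph_ext H) x) <> [::].
  by apply: subst_neq0 => [b|]; [apply: (@blockN)|apply: iter_morph_neq0].
by case: (subst _ _) => //= *; lia.
Qed.

Let words_mono n m : exists z,
  iter (n + m) (morph_ext h) [:: a] = iter n (morph_ext h) [:: a] ++ z.
Proof.
have [y [hy _]] := step.
have S k : exists z, iter k.+1 (morph_ext h) [:: a] = iter k (morph_ext h) [:: a] ++ z.
  exists (iter k (morph_ext h) y).
  by rewrite iterSr -iter_morph_cat /= morph_extE subst_seq1 hy.
elim: m => [|m [z IH]]; first by exists [::]; rewrite addn0 cats0.
have [z' Ez] := S (n + m); exists (z ++ z').
by rewrite addnS Ez IH catA.
Qed.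

(** A diagonal choice: [h^i(a)] has more than [i] letters, and all these words are prefixes of each
    other. *)
Let beta i := nth a (iter i (morph_ext h) [:: a]) i.

Let beta_prefix : is_h_omega h a beta.
Proof.
move=> n i d lti; rewrite /beta (set_nth_default a) //.
have [z1 E1] := words_mono n i; have [z2 E2] := words_mono i n.
have F1 : nth a (iter (n + i) (morph_ext h) [:: a]) i = nth a (iter n (morph_ext h) [:: a]) i.
  by rewrite E1 nth_cat lti.
by rewrite -F1 addnC E2 nth_cat size_word.
Qed.

Lemma morphic_series_aux : morphic alpha.
Proof.
exists B', h, e, a; split; first exact: step.
exists beta; split; first exact: beta_prefix.
move=> i; rewrite -(beta_prefix (n := i.+1) a); last exact: ltnW (size_word _).
rewrite -(nth_map a (alpha 0)); last exact: ltnW (size_word _).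
have E : map e (iter i.+1 (morph_ext h) [:: a]) = p ++ subst g (series H x i.+1).
  by rewrite words e_blocks iter_H' subst_cons subst_map.
rewrite E pref // -E size_map; exact: ltnW (size_word _).
Qed.
End SeriesMorphic.

(** The factor [g(x)] is moved into the initial word, which thereby becomes nonempty as the block
    construction demands; the series then starts at [H(x)]. *)
Lemma morphic_series (A : Type) (alpha : nat -> A) (B : finType)
  (H : B -> seq B) (g : B -> seq A) (p : seq A) (x : seq B) :
  (forall b, H b <> [::]) -> (forall b, g b <> [::]) -> x <> [::] ->
  (forall n, is_prefix (p ++ subst g (series H x n)) alpha) -> morphic alpha.
Proof.
move=> HN gN xN P.
apply: (@morphic_series_aux _ alpha B H g (p ++ subst g x) (morph_ext H x)) => //.
- exact: subst_neq0.
- move=> /(congr1 size); rewrite size_cat.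
  by have := subst_neq0 gN xN; case: (subst g x) => //= *; lia.
- by move=> n; rewrite -catA -subst_cat -series_shift.
Qed.

Lemma finite_repetition (T : finType) (f : nat -> T) : exists i d, 0 < d /\ f (i + d) = f i.
Proof.
have : ~~ injectiveb (fun i : 'I_#|T|.+1 => f i).
  apply/negP => /injectiveP /leq_card; rewrite card_ord; lia.
case/injectivePn => i [j ne Eij].
wlog lt : i j ne Eij / i < j.
  move=> W; case: (ltngtP i j) => [|lt|/val_inj E]; first exact: W Eij.
    by apply: (W j i) => //; rewrite eq_sym.
  by rewrite E eqxx in ne.
by exists i, (j - i); rewrite subn_gt0 lt subnKC // ltnW.
Qed.

(** From index [i] on the orbit has period [d]. As [p] is a multiple of [d] and at least [i],
    another [p] iterations change nothing. The free factor [q] makes a common exponent for several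
    orbits possible. *)
Lemma iter_idempotent (T : Type) (F : T -> T) x i d q :
  iter (i + d) F x = iter i F x -> 0 < d -> 0 < q ->
  let p := q * (i.+1 * d) in iter p F (iter p F x) = iter p F x.
Proof.
move=> E d0 q0 p.
have S k : iter (i + k * d) F x = iter i F x.
  elim: k => [|k IH]; first by rewrite mul0n addn0.
  by rewrite mulSn addnA addnC iterD E -iterD addnC.
have {}S k j : iter (j + i + k * d) F x = iter (j + i) F x.
  by rewrite -addnA iterD S -iterD.
have le : i <= p by rewrite /p; nia.
rewrite -iterD -{1}(subnK le) -[in X in _ + X](_ : (q * i.+1) * d = p) ?S ?subnK //.
by rewrite /p mulnA.
Qed.

Lemma common_multiple (T : finType) (P : T -> nat -> Prop) :
  (forall b, exists2 m, 0 < m & forall q, 0 < q -> P b (q * m)) ->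
  exists2 p, 0 < p & forall b, P b p.
Proof.
move=> E; have /fin_all_exists [m mP] : forall b, exists m, 0 < m /\ forall q, 0 < q -> P b (q * m).
  by move=> b; have [m] := E b; exists m.
have pos : 0 < \prod_b m b by rewrite prodn_gt0 // => b; case: (mP b).
exists (\prod_b m b) => // b.
have [_ +] := mP b; rewrite (bigD1 b) //= mulnC; apply.
by rewrite prodn_gt0 // => c; case: (mP c).
Qed.

(** * Bounded and unbounded letters of a nonerasing morphism *)

Section D0L.
Variables (B : finType) (H : B -> seq B).
Hypothesis HN : forall b, H b <> [::].
Notation M := (morph_ext H).

Definition bounded_letter (b : B) := exists K, forall n, size (iter n M [:: b]) <= K.
Definition bounded_word (y : seq B) := forall b, b \in y -> bounded_letter b.

Lemma size_iter_leq n m x : n <= m -> size (iter n M x) <= size (iter m M x).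
Proof.
move=> /subnK <-; rewrite iterD; elim: (m - n) => //= k IH.
exact: leq_trans IH (size_subst _ HN).
Qed.

Lemma bounded_word_size y : bounded_word y -> exists K, forall n, size (iter n M y) <= K.
Proof.
elim: y => [|b y IH] by_; first by exists 0 => n; rewrite iter_morph_nil.
have [K1 P1] := by_ b (mem_head _ _).
have [c cy|K2 P2] := IH; first by apply: by_; rewrite inE cy orbT.
exists (K1 + K2) => n; rewrite -cat1s iter_morph_cat size_cat leq_add //.
Qed.

Lemma bounded_word_of_size K y : (forall n, size (iter n M y) <= K) -> bounded_word y.
Proof.
move=> P b by_; case/splitPr: by_ P => y1 y2 P; exists K => n.
by apply: leq_trans (P n); rewrite -(cat1s b y2) 2!iter_morph_cat 2!size_cat addnCA leq_addr.
Qed.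

Lemma bounded_word_morph y : bounded_word y -> bounded_word (M y).
Proof.
move=> /bounded_word_size[K P]; apply: (@bounded_word_of_size K) => n.
by rewrite -iterSr.
Qed.

Lemma bounded_word_cat y z : bounded_word y -> bounded_word z -> bounded_word (y ++ z).
Proof. by move=> P Q b; rewrite mem_cat => /orP[/P|/Q]. Qed.

Lemma first_unbounded y : bounded_word y \/
  exists y1 b y2, [/\ y = y1 ++ b :: y2, bounded_word y1 & ~ bounded_letter b].
Proof.
elim: y => [|c y IH]; first by left.
have [bc|nbc] := classic (bounded_letter c); last by right; exists [::], c, y.
case: IH => [by_|[y1 [b [y2 [-> by1 nb]]]]].
  by left=> b; rewrite inE => /orP[/eqP->|/by_].
by right; exists (c :: y1), b, y2; split=> // d; rewrite inE => /orP[/eqP->|/by1].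
Qed.

(** If all letters of [H b] were bounded, some [K] would bound the iterates of [H b], so [maxn 1 K]
    would bound those of [b], the 1 covering iterate 0. Hence [phi b] can be the first unbounded
    letter of [H b]. *)
Lemma leading_unbounded : exists phi : B -> B, forall b, ~ bounded_letter b ->
  exists y z, [/\ H b = y ++ phi b :: z, bounded_word y & ~ bounded_letter (phi b)].
Proof.
suff /fin_all_exists : forall b, exists c, ~ bounded_letter b ->
  exists y z, [/\ H b = y ++ c :: z, bounded_word y & ~ bounded_letter c] by [].
move=> b; have [|nb] := classic (bounded_letter b); first by exists b.
case: (first_unbounded (H b)) => [|[y [c [z ?]]]]; last by exists c; exists y, z.
move=> /bounded_word_size[K P]; case: nb; exists (maxn 1 K) => -[|n]; first by rewrite /= leq_max.
by rewrite iterSr morph_extE subst_seq1 leq_max P orbT.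
Qed.

Lemma leading_unbounded_iter phi n b :
  (forall b, ~ bounded_letter b ->
    exists y z, [/\ H b = y ++ phi b :: z, bounded_word y & ~ bounded_letter (phi b)]) ->
  ~ bounded_letter b ->
  exists y z, [/\ iter n M [:: b] = y ++ iter n phi b :: z, bounded_word y
                & ~ bounded_letter (iter n phi b)].
Proof.
move=> P nb; elim: n => [|n [y [z [E by_ nbn]]]]; first by exists [::], [::].
have [y' [z' [E' by' nb']]] := P _ nbn.
exists (M y ++ y'), (z' ++ M z); split=> //=.
  by rewrite E !morph_extE subst_cat subst_cons E' -!catA.
exact: bounded_word_cat (bounded_word_morph by_) by'.
Qed.

Lemma bounded_letter_periodic b : bounded_letter b ->
  exists i d, 0 < d /\ iter (i + d) M [:: b] = iter i M [:: b].
Proof.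
case=> K P; have [i [d [d0 E]]] := finite_repetition (fun n => Bseq (P n)).
by exists i, d; split=> //; move/(congr1 val): E.
Qed.

Lemma morphic_D0L (A : Type) (alpha : nat -> A) (g : B -> seq A) (W : seq B) :
  (forall b, g b <> [::]) -> (forall K, exists n, K <= size (iter n M W)) ->
  (forall n, is_prefix (subst g (iter n M W)) alpha) -> morphic alpha.
Proof.
move=> gN unb pref.
have [phi phiP] := leading_unbounded.
(* One power serves all letters: [T = H^p] is idempotent on bounded words and [phi^p] is idempotent.
   For [b = phi^p(b0)] this gives [phi^p(b) = b], so [T b = y b z] with [y] bounded. *)
have [p p0 pP] : exists2 p, 0 < p & forall b,
    (bounded_letter b -> iter p M (iter p M [:: b]) = iter p M [:: b]) /\
    iter p phi (iter p phi b) = iter p phi b.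
  apply: common_multiple => b.
  have [i [d [d0 E]]] := finite_repetition (fun n => iter n phi b).
  have [bb|nb] := classic (bounded_letter b); last first.
    exists (i.+1 * d); first by nia.
    by move=> q q0; split=> //; apply: iter_idempotent.
  have [j [c [c0 F]]] := bounded_letter_periodic bb.
  exists (i.+1 * d * (j.+1 * c)); first by nia.
  move=> q q0; split=> [_|]; first by rewrite mulnA; apply: iter_idempotent => //; nia.
  by rewrite [_ * (j.+1 * c)]mulnC mulnA; apply: iter_idempotent => //; nia.
pose T := iter p M.
have Tcat x y : T (x ++ y) = T x ++ T y by apply: iter_morph_cat.
have TT y : bounded_word y -> T (T y) = T y.
  elim: y => [|b y IH] by_; first by rewrite /T !iter_morph_nil.
  rewrite -cat1s !Tcat IH; last by move=> c cy; apply: by_; rewrite inE cy orbT.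
  by congr (_ ++ _); apply: (pP b).1; apply: by_; rewrite mem_head.
have prefT n : is_prefix (subst g (iter n T W)) alpha.
  have -> : iter n T W = iter (n * p) M W; last exact: pref.
  by elim: n => // n IH; rewrite mulSn iterD -IH.
have [|[y0 [b0 [z0 [EW by0 nb0]]]]] := first_unbounded W.
  case/bounded_word_size => K PK; have [n] := unb K.+1; by rewrite ltnNge PK.
have [y1 [z1 [E1 by1 nb]]] := leading_unbounded_iter p phiP nb0.
have [y [z [Ey by_ _]]] := leading_unbounded_iter p phiP nb.
rewrite (pP b0).2 in Ey; set b := iter p phi b0 in E1 nb Ey.
rewrite -/(T _) in E1 Ey.
have Tconst n u : bounded_word u -> iter n.+1 T u = T u.
  by move=> bu; elim: n => // n IH; rewrite iterS IH TT.
have TWcat n u v : iter n T (u ++ v) = iter n T u ++ iter n T v.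
  by elim: n => //= n ->; rewrite Tcat.
(* One application of [T] reaches [b]; at least one more is needed for the bounded word [y1] to
   become the stable word [T y1]. *)
have Wpref n : exists v, iter n.+2 T W = (T y0 ++ T y1) ++ iter n.+1 T [:: b] ++ v.
  rewrite EW -cat1s 2!TWcat Tconst // (iterSr n.+1 T [:: b0]) E1 -cat1s 2!TWcat Tconst //.
  by eexists; rewrite -!catA.
(* If [y] is empty, [T^n(b)] is [b] followed by the series of [z] under [T]. Otherwise [T^(n+1)(b)]
   begins with [n] copies of the stable word [T y]; the word is ultimately periodic and is treated
   as a series of the identity morphism. *)
have [y_nil|yN] : y = [::] \/ y <> [::] by case: (y); [left|right].
  rewrite {}y_nil /= in Ey.
  (* Otherwise [T] fixes [b], and since lengths never decrease along the iteration, [b] would be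
     bounded. *)
  have zN : z <> [::].
    move=> z_nil; rewrite z_nil in Ey; apply: nb; exists 1 => n.
    apply: leq_trans (_ : size (iter (n * p) M [:: b]) <= _).
      by apply: size_iter_leq; nia.
    suff -> : iter (n * p) M [:: b] = [:: b] by [].
    by elim: n => // n IH; rewrite mulSn iterD IH.
  pose Hp c := T [:: c].
  have HpE u : morph_ext Hp u = T u.
    elim: u => [|c u IH]; first by rewrite /T iter_morph_nil.
    by rewrite -cat1s Tcat -IH !morph_extE subst_cat subst_seq1.
  have iterb n : iter n T [:: b] = b :: series Hp z n.
    elim: n => // n IH; rewrite iterS IH -cat1s Tcat.
    by rewrite [T [:: b]]Ey series_recl HpE.
  apply: (@morphic_series _ alpha B Hp g (subst g (T y0 ++ T y1 ++ [:: b])) z) => //.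
    by move=> c; apply: iter_morph_neq0.
  move=> n; have [v Ev] := Wpref n; have := prefT n.+2; rewrite Ev iterb seriesS.
  move=> P; apply: (@is_prefix_catl _ _ (subst g (iter n (morph_ext Hp) z ++ v))).
  by move: P; rewrite -!subst_cat -?catA /= -?catA.
have iterb n : exists v, iter n.+1 T [:: b] = flatten (nseq n (T y)) ++ y ++ b :: v.
  elim: n => [|n [v IH]]; first by exists z.
  exists (z ++ T v); rewrite iterS IH -cat1s !Tcat [T [:: b]]Ey.
  have -> : T (flatten (nseq n (T y))) = flatten (nseq n (T y)).
    by elim: (n) => [|k IHk] /=; [rewrite /T iter_morph_nil|rewrite Tcat IHk TT].
  have -> : flatten (nseq n.+1 (T y)) = flatten (nseq n (T y)) ++ T y.
    by rewrite -addn1 nseqD flatten_cat /= cats0.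
  by rewrite -!catA.
apply: (@morphic_series _ alpha B (fun c => [:: c]) g (subst g (T y0 ++ T y1)) (T y)) => //.
  exact: iter_morph_neq0.
move=> n; have [v Ev] := Wpref n; have [v' Ev'] := iterb n.
have := prefT n.+2; rewrite Ev Ev'.
have -> : series (fun c => [:: c]) (T y) n = flatten (nseq n (T y)).
  elim: n {Ev v Ev' v'} => // n IH; rewrite series_recl IH.
  by rewrite morph_extE subst_pure.
by rewrite -[(_ ++ y ++ _) ++ v]catA [_ ++ (_ ++ _)]catA !subst_cat => /is_prefix_catl.
Qed.
End D0L.

(** * Derivations in indexed grammars *)

(** Classical decision as a boolean: it puts the profiles of stacks into a finite type and lets
    positive edges be counted. *)
Definition truth (P : Prop) : bool := if excluded_middle_informative P then true else false.

Lemma truthP (P : Prop) : reflect P (truth P).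
Proof. by rewrite /truth; case: excluded_middle_informative => p; constructor. Qed.

Lemma map_eq_cat (S T : Type) (f : S -> T) x t1 t2 : map f x = t1 ++ t2 ->
  exists x1 x2, [/\ x = x1 ++ x2, map f x1 = t1 & map f x2 = t2].
Proof.
move=> E; exists (take (size t1) x), (drop (size t1) x); rewrite cat_take_drop.
by rewrite map_take map_drop E take_size_cat // drop_size_cat.
Qed.

Section Derivations.
Variables (A : finType) (G : indexed_grammar A).
Local Notation N := (ig_N G).
Local Notation F := (ig_F G).
Local Notation form := (sform G).
Local Notation symbol := (A + (N * seq F))%type.
Local Notation letter := (A + N)%type.

Definition edge (X : N) (xi : seq F) (s : form) : Prop :=
  (exists rhs, List.In (X, rhs) (ig_prods G) /\ s = map (@inst_prod A G xi) rhs) \/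
  (exists f xi' rhs, xi = f :: xi' /\ List.In (f, X, rhs) (ig_flag_prods G) /\
     s = map (@inst_flag A G xi') rhs).

(** Derivations in tree shape: the symbols of a form are rewritten independently of each other, so
    that induction follows the derivation forest. [derivesE] shows the agreement with sequences of
    steps. *)
Inductive der : form -> form -> Prop :=
| der_nil : der [::] [::]
| der_keep c s t : der s t -> der (c :: s) (c :: t)
| der_step X xi r s t1 t2 :
    edge X xi r -> der r t1 -> der s t2 -> der (inr (X, xi) :: s) (t1 ++ t2).

Definition term (w : seq A) : form := map inl w.

Lemma der_refl s : der s s.
Proof. by elim: s => [|c s IH]; constructor. Qed.

Lemma der_cat s1 s2 t1 t2 : der s1 t1 -> der s2 t2 -> der (s1 ++ s2) (t1 ++ t2).
Proof.
move=> D1 D2; elim: D1 => //= [c s t _ IH|X xi r s u v E Dr _ _ IH]; first exact: der_keep.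
by rewrite -catA; apply: der_step E Dr IH.
Qed.

Lemma der_split s1 s2 t : der (s1 ++ s2) t ->
  exists t1 t2, [/\ t = t1 ++ t2, der s1 t1 & der s2 t2].
Proof.
elim: s1 t => [|c s1 IH] t /= D; first by exists [::], t; split=> //; apply: der_nil.
move E: (c :: s1 ++ s2) D => s D; case: D E => // [c' s' t' D [-> E]|X xi r s' u v Ed Dr D [-> E]].
  move: E D => <- /IH[t1 [t2 [-> D1 D2]]]; exists (c' :: t1), t2.
  by split=> //; apply: der_keep.
move: E D => <- /IH[t1 [t2 [-> D1 D2]]]; exists (u ++ t1), t2.
by rewrite catA; split=> //; apply: der_step Ed Dr D1.
Qed.

Lemma der_trans s t u : der s t -> der t u -> der s u.
Proof.
move=> D; elim: D u => // [c s' t' _ IH|X xi r s' t1 t2 Ed _ IH1 _ IH2] u.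
  rewrite -(cat1s c t') -(cat1s c s') => /der_split[u1 [u2 [-> D1 D2]]]; exact: der_cat D1 (IH _ D2).
move=> /der_split[u1 [u2 [-> D1 D2]]].
exact: der_step Ed (IH1 _ D1) (IH2 _ D2).
Qed.

Lemma der_edge X xi s t : edge X xi s -> der s t -> der [:: inr (X, xi)] t.
Proof. by move=> E D; rewrite -[t]cats0; apply: der_step E D der_nil. Qed.

Lemma der_middle s t s1 s2 : der s t -> der (s1 ++ s ++ s2) (s1 ++ t ++ s2).
Proof. by move=> D; apply: der_cat (der_refl _) (der_cat D (der_refl _)). Qed.

Lemma ig_stepE (u v : form) : ig_step u v <->
  exists pre post X xi s,
    [/\ u = pre ++ inr (X, xi) :: post, edge X xi s & v = pre ++ s ++ post].
Proof.
split.
  case=> pre [post [X [xi [-> [[rhs [i ->]]|[f [xi' [rhs [-> [i ->]]]]]]]]]].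
    by exists pre, post, X, xi, (map (@inst_prod A G xi) rhs); split=> //; left; exists rhs.
  exists pre, post, X, (f :: xi'), (map (@inst_flag A G xi') rhs); split=> //.
  by right; exists f, xi', rhs.
case=> pre [post [X [xi [s [-> [[rhs [i ->]]|[f [xi' [rhs [-> [i ->]]]]]] ->]]]]].
  by exists pre, post, X, xi; split=> //; left; exists rhs.
by exists pre, post, X, (f :: xi'); split=> //; right; exists f, xi', rhs.
Qed.

Lemma derives_cat_middle (s t pre post : form) :
  ig_derives s t -> ig_derives (pre ++ s ++ post) (pre ++ t ++ post).
Proof.
elim=> {s t} [s t /ig_stepE[p [q [X [xi [r [-> E ->]]]]]]|s|s t u _ IH1 _ IH2].
- apply: rt_step; apply/ig_stepE; exists (pre ++ p), (q ++ post), X, xi, r.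
  by split=> //; rewrite -!catA.
- exact: rt_refl.
- exact: rt_trans IH1 IH2.
Qed.

Lemma derivesE (s t : form) : ig_derives s t <-> der s t.
Proof.
split.
  elim=> {s t} [s t /ig_stepE[p [q [X [xi [r [-> E ->]]]]]]|s|s t u _ IH1 _ IH2].
  - by rewrite -cat1s; apply: der_middle (der_edge E (der_refl _)).
  - exact: der_refl.
  - exact: der_trans IH1 IH2.
elim=> {s t} [|c s t _ IH|X xi r s t1 t2 E _ IH1 _ IH2]; first exact: rt_refl.
  by have := derives_cat_middle [:: c] [::] IH; rewrite !cats0.
apply: (rt_trans _ _ _ (r ++ s)).
  by apply: rt_step; apply/ig_stepE; exists [::], s, X, xi, r.
apply: (rt_trans _ _ _ (t1 ++ s)); first exact: (derives_cat_middle [::] s IH1).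
by have := derives_cat_middle t1 [::] IH2; rewrite !cats0.
Qed.

(** * Separating the top of a stack from the flags below it *)

Definition lift1 (sigma : seq F) (c : symbol) : symbol :=
  match c with inl a => inl a | inr (X, xi) => inr (X, xi ++ sigma) end.
Definition lift sigma (s : form) : form := map (lift1 sigma) s.

(** Words over terminals and bare nonterminals record what is left of a derivation once all flags
    above [sigma] are consumed. *)
Definition place1 (sigma : seq F) (c : letter) : symbol :=
  match c with inl a => inl a | inr X => inr (X, sigma) end.
Definition place sigma (n : seq letter) : form := map (place1 sigma) n.

Lemma lift_cat sigma s t : lift sigma (s ++ t) = lift sigma s ++ lift sigma t.
Proof. exact: map_cat. Qed.

Lemma place_cat sigma m n : place sigma (m ++ n) = place sigma m ++ place sigma n.
Proof. exact: map_cat. Qed.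

Lemma lift_place sigma rho n : lift sigma (place rho n) = place (rho ++ sigma) n.
Proof. by rewrite /lift /place -map_comp; apply: eq_map => -[]. Qed.

Lemma lift_lift sigma rho s : lift sigma (lift rho s) = lift (rho ++ sigma) s.
Proof.
by rewrite /lift -map_comp; apply: eq_map => -[a|[X xi]] //=; rewrite catA.
Qed.

Lemma lift_nil s : lift [::] s = s.
Proof. by rewrite /lift -[RHS]map_id; apply: eq_map => -[a|[X xi]] //=; rewrite cats0. Qed.

Lemma edge_lift sigma X xi s : edge X xi s -> edge X (xi ++ sigma) (lift sigma s).
Proof.
case=> [[rhs [i ->]]|[f [xi' [rhs [-> [i ->]]]]]]; [left|right].
  exists rhs; split=> //; rewrite /lift -map_comp; apply: eq_map => -[a|Y psi] //=.
  by rewrite catA.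
exists f, (xi' ++ sigma), rhs; split=> //; split=> //.
by rewrite /lift -map_comp; apply: eq_map => -[].
Qed.

(** An edge inspects at most the top flag, so with [f] on top it is independent of [sigma]. *)
Lemma edge_unlift sigma X f psi s : edge X (f :: psi ++ sigma) s ->
  exists s', s = lift sigma s' /\ edge X (f :: psi) s'.
Proof.
case=> [[rhs [i ->]]|[f' [xi' [rhs [[<- <-] [i ->]]]]]].
  exists (map (@inst_prod A G (f :: psi)) rhs); split; last by left; exists rhs.
  rewrite /lift -map_comp; apply: eq_map => -[a|Y chi] //=.
  by rewrite -catA.
exists (map (@inst_flag A G psi) rhs); split; last by right; exists f, psi, rhs.
by rewrite /lift -map_comp; apply: eq_map => -[].
Qed.

Lemma der_lift sigma s t : der s t -> der (lift sigma s) (lift sigma t).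
Proof.
elim=> [|c s' t' _ IH|X xi r s' t1 t2 E _ IH1 _ IH2]; first exact: der_nil.
  exact: der_keep.
by rewrite lift_cat; apply: der_step (edge_lift sigma E) IH1 IH2.
Qed.

(* The part of a derivation above [sigma] separates from the part that consumes [sigma]. *)
Lemma der_unlift sigma s w : der (lift sigma s) (term w) ->
  exists n, der s (place [::] n) /\ der (place sigma n) (term w).
Proof.
move Et: (lift sigma s) => t; move Eu: (term w) => u D.
elim: D s w Et Eu => {t u} [|c t u _ IH|X xi r t u1 u2 E D1 IH1 D2 IH2] [|d s] w //=.
- by move=> _ _; exists [::]; split; apply: der_nil.
- case: w => // a w [Ed /IH {}IH] [Ec Eu].
  have {IH} [n [Dn1 Dn2]] := IH _ Eu.
  exists (inl a :: n); rewrite -Ec in Ed *.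
  case: d Ed => [b [->]|[]//]; split; exact: der_keep.
- case: d => // -[Y xi0] [EY Exi Es] Eu; rewrite {Y}EY.
  have [w1 [w2 [_ E1 E2]]] := map_eq_cat Eu.
  have [n0 [Dn1 Dn2]] := IH2 _ _ Es E2.
  (* If nothing lies above [sigma], the node is kept in [n] and its whole subtree goes to the lower
     part. Otherwise the edge leaves [sigma] untouched and belongs to the upper part. *)
  case: xi0 Exi => [/= Exi|f psi Exi].
    exists (inr X :: n0); split; first exact: der_keep.
    by rewrite -Exi in E; apply: der_step E D1 Dn2.
  rewrite -Exi in E; have [r' [Er E']] := edge_unlift E.
  have [n1 [Dm1 Dm2]] := IH1 _ _ (esym Er) E1.
  exists (n1 ++ n0); rewrite !place_cat; split; first exact: der_step E' Dm1 Dn1.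
  exact: der_cat.
Qed.

(** * Productive and positive forms, and the profile of a stack *)

Definition productive (s : form) := exists w, der s (term w).
Definition positive (s : form) := exists w, w <> [::] /\ der s (term w).

Lemma positive_productive s : positive s -> productive s.
Proof. by case=> w [_ D]; exists w. Qed.

Lemma productive_cat s t : productive (s ++ t) <-> productive s /\ productive t.
Proof.
split=> [[w /der_split[t1 [t2 [/map_eq_cat[w1 [w2 [_ <- <-]]] D1 D2]]]]|[[w1 D1] [w2 D2]]].
  by split; [exists w1|exists w2].
by exists (w1 ++ w2); rewrite /term map_cat; apply: der_cat.
Qed.

Lemma positive_cat s t :
  positive (s ++ t) <-> [/\ productive s, productive t & positive s \/ positive t].
Proof.
split=> [[w [wN /der_split[t1 [t2 [/map_eq_cat[w1 [w2 [Ew <- <-]]] D1 D2]]]]]|].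
  split; [by exists w1|by exists w2|].
  case: w1 Ew D1 => [|a w1] Ew D1; last by left; exists (a :: w1).
  by right; exists w2; rewrite /= in Ew; rewrite -Ew in D2 *.
case=> [[v1 E1] [v2 E2]] [[w [wN D]]|[w [wN D]]].
  exists (w ++ v2); split; first by case: w wN {D}.
  by rewrite /term map_cat; apply: der_cat.
exists (v1 ++ w); split; first by case: (v1) => //; case: w wN {D}.
by rewrite /term map_cat; apply: der_cat.
Qed.

Lemma productive_placeP sigma n : productive (place sigma n) <->
  forall c, c \in n -> productive [:: place1 sigma c].
Proof.
elim: n => [|c n IH]; first by split=> // _; exists [::]; apply: der_nil.
rewrite [place _ _]/= -cat1s productive_cat IH; split=> [[Pc Pn] d|P].
  by rewrite inE => /orP[/eqP->|/Pn].
by split=> [|d dn]; apply: P; rewrite inE ?eqxx // dn orbT.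
Qed.

Lemma positive_placeP sigma n : positive (place sigma n) <->
  productive (place sigma n) /\ exists2 c, c \in n & positive [:: place1 sigma c].
Proof.
elim: n => [|c n IH].
  split=> [[[|a w] [wN D]]//|[_ [//]]].
  by inversion D.
rewrite [place _ _]/= -cat1s productive_cat positive_cat; split.
  case=> Pc Pn [Rc|/IH[_ [d dn Rd]]]; split=> //; first by exists c; rewrite ?mem_head.
  by exists d; rewrite // inE dn orbT.
case=> -[Pc Pn] [d]; rewrite inE => /orP[/eqP->|dn] Rd; split=> //; first by left.
by right; apply/IH; split=> //; exists d.
Qed.

(** Only the set of letters counts, so side branches to the left and to the right of a path may be
    regrouped freely. *)
Lemma eq_productive sigma m n : m =i n -> productive (place sigma m) -> productive (place sigma n).
Proof. by move=> E /productive_placeP P; apply/productive_placeP => c; rewrite -E; apply: P. Qed.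

Lemma eq_positive sigma m n : m =i n -> positive (place sigma m) -> positive (place sigma n).
Proof.
move=> E /positive_placeP[P [c cm R]]; apply/positive_placeP; split; first exact: eq_productive P.
by exists c => //; rewrite -E.
Qed.

Definition ty (sigma : seq F) : {ffun N -> bool * bool} :=
  [ffun X => (truth (productive [:: inr (X, sigma)]), truth (positive [:: inr (X, sigma)]))].

Lemma ty_productive1 sigma tau c : ty sigma = ty tau ->
  productive [:: place1 sigma c] -> productive [:: place1 tau c].
Proof.
case: c => [//|X] /ffunP/(_ X); rewrite !ffunE => -[E _] /=.
by move=> /truthP; rewrite E => /truthP.
Qed.

Lemma ty_positive1 sigma tau c : ty sigma = ty tau ->
  positive [:: place1 sigma c] -> positive [:: place1 tau c].
Proof.
case: c => [//|X] /ffunP/(_ X); rewrite !ffunE => -[_ E] /=.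
by move=> /truthP; rewrite E => /truthP.
Qed.

Lemma ty_productive sigma tau n : ty sigma = ty tau ->
  productive (place sigma n) -> productive (place tau n).
Proof.
move=> E /productive_placeP P; apply/productive_placeP => c /P.
exact: ty_productive1.
Qed.

Lemma ty_positive sigma tau n : ty sigma = ty tau ->
  positive (place sigma n) -> positive (place tau n).
Proof.
move=> E /positive_placeP[P [c cn R]]; apply/positive_placeP.
by split; [apply: ty_productive P|exists c => //; apply: ty_positive1 R].
Qed.

(** One [n] serves both properties: it comes from splitting a derivation of a nonempty word if there
    is one, and of any word otherwise. *)
Lemma productive_choose sigma s : productive (lift sigma s) ->
  exists n, [/\ der s (place [::] n), productive (place sigma n)
              & positive (lift sigma s) -> positive (place sigma n)].
Proof.
move=> P; have [[w [wN /der_unlift[n [D1 D2]]]]|R] := classic (positive (lift sigma s)).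
  by exists n; split=> //; [exists w|move=> _; exists w].
by have [w /der_unlift[n [D1 D2]]] := P; exists n; split=> //; exists w.
Qed.

Lemma productive_der s t : der s t -> productive t -> productive s.
Proof. by move=> D [w Dw]; exists w; apply: der_trans Dw. Qed.

Lemma positive_der s t : der s t -> positive t -> positive s.
Proof. by move=> D [w [wN Dw]]; exists w; split=> //; apply: der_trans Dw. Qed.

(** Consuming [rho] leaves a word placed on [sigma], and the profile of [sigma] decides whether that
    word is productive or positive; the same derivation above works over [tau]. *)
Lemma ty_cat rho sigma tau : ty sigma = ty tau -> ty (rho ++ sigma) = ty (rho ++ tau).
Proof.
move=> E; apply/ffunP => X; rewrite !ffunE.
have W s1 s2 : ty s1 = ty s2 ->
    (productive [:: inr (X, rho ++ s1)] -> productive [:: inr (X, rho ++ s2)]) /\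
    (positive [:: inr (X, rho ++ s1)] -> positive [:: inr (X, rho ++ s2)]).
  move=> E12; have L s : [:: inr (X, rho ++ s)] = lift s [:: inr (X, rho)] by [].
  rewrite !L; split=> P.
    have [n [/(der_lift s2) D Pn _]] := productive_choose P.
    by apply: productive_der D _; rewrite lift_place; apply: ty_productive E12 _.
  have [n [/(der_lift s2) D _ /(_ P) Rn]] := productive_choose (positive_productive P).
  by apply: positive_der D _; rewrite lift_place; apply: ty_positive E12 _.
have [P1 R1] := W _ _ E; have [P2 R2] := W _ _ (esym E).
by congr (_, _); apply/truthP/truthP.
Qed.

(** * Paths in derivation trees as runs of a pushdown system *)

Definition hole (rho : seq F) (Y : option N) : form :=
  if Y is Some Z then [:: inr (Z, rho)] else [::].

Lemma lift_hole sigma rho Y : lift sigma (hole rho Y) = hole (rho ++ sigma) Y.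
Proof. by case: Y. Qed.

(* [seg sigma psi X Y k]: a path in a derivation tree from [(X, psi ++ sigma)]
   that pops exactly [psi] and arrives at [(Y, sigma)], or stops before that if
   [Y = None]; [k] counts the edges of the path with a sibling that can yield a
   nonempty word. *)
Inductive seg : seq F -> seq F -> N -> option N -> nat -> Prop :=
| seg_nil sigma X : seg sigma [::] X (Some X) 0
| seg_stop sigma psi X : productive [:: inr (X, psi ++ sigma)] -> seg sigma psi X None 0
| seg_cons sigma f psi X Z Y k1 k2 :
    seg (psi ++ sigma) [:: f] X (Some Z) k1 -> seg sigma psi Z Y k2 ->
    seg sigma (f :: psi) X Y (k1 + k2)
| seg_consN sigma f psi X k :
    seg (psi ++ sigma) [:: f] X None k -> seg sigma (f :: psi) X None k
| seg_step sigma f X l Z psi r Y k :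
    edge X [:: f] (l ++ inr (Z, psi) :: r) -> productive (lift sigma (l ++ r)) ->
    seg sigma psi Z Y k ->
    seg sigma [:: f] X Y (k + truth (positive (lift sigma (l ++ r)))).

Lemma seg_split sigma psi1 psi2 X Y k : seg sigma (psi1 ++ psi2) X Y k ->
  (exists Z k1 k2, [/\ seg (psi2 ++ sigma) psi1 X (Some Z) k1, seg sigma psi2 Z Y k2 & k = k1 + k2])
  \/ (Y = None /\ seg (psi2 ++ sigma) psi1 X None k).
Proof.
elim: psi1 X k => [|f psi1 IH] X k S.
  by left; exists X, 0, k; split=> //; apply: seg_nil.
move Epsi: ((f :: psi1) ++ psi2) S => psi S.
case: S Epsi IH => {sigma psi X Y k}.
- by [].
- by move=> sigma psi X P Epsi _; right; split=> //; apply: seg_stop; rewrite catA Epsi.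
- move=> sigma f' psi X Z Y k1 k2 S1 S2 /= [-> Epsi] IH; rewrite -Epsi in S1 S2.
  case: (IH _ _ S2) => [[Z' [k3 [k4 [S3 S4 ->]]]]|[-> S3]].
    left; exists Z', (k1 + k3), k4; rewrite addnA; split=> //.
    by apply: seg_cons S3; rewrite catA.
  by right; split=> //; apply: seg_cons S3; rewrite catA.
- move=> sigma f' psi X k S /= [-> Epsi] _; rewrite -Epsi in S.
  by right; split=> //; apply: seg_consN; rewrite catA.
- move=> sigma f' X l Z psi r Y k E P S /= [->]; case: psi1 => //; case: psi2 => // _ _ /=.
  have {}S := seg_step E P S; case: Y S => [Y|] S; last by right.
  left; exists Y; do 2!eexists; split; [exact: S|exact: seg_nil|by rewrite addn0].
Qed.

(** [seg_step] handles stacks of a single flag only. Here the edge is restricted to its top flag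
    [f], and the rest of the path is cut by [seg_split] where the flags replacing [f] have been
    popped. *)
Lemma seg_edge sigma f psi X l Z xi r Y k :
  edge X (f :: psi) (l ++ inr (Z, xi) :: r) -> productive (lift sigma (l ++ r)) ->
  seg sigma xi Z Y k ->
  seg sigma (f :: psi) X Y (k + truth (positive (lift sigma (l ++ r)))).
Proof.
move=> E P S; have [s [Es E']] := @edge_unlift psi X f [::] _ E.
have [l' [cr [Es' El Er]]] := map_eq_cat (esym Es).
case: cr Er Es' => [//|[//|[Z' psi']] r'] /= [EZ Exi Er] Es'.
subst l r Z' xi s; rewrite -!/(lift _ _) -lift_cat lift_lift in P *.
case: (seg_split S) => [[Z1 [k1 [k2 [S1 S2 ->]]]]|[-> S1]].
  by rewrite addnAC; apply: seg_cons S2; apply: seg_step E' _ S1.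
by apply: seg_consN; apply: seg_step E' _ S1.
Qed.

Lemma choose_pair sigma s1 s2 : productive (lift sigma (s1 ++ s2)) ->
  exists n1 n2, [/\ der s1 (place [::] n1), der s2 (place [::] n2),
    productive (place sigma (n1 ++ n2)) &
    positive (lift sigma (s1 ++ s2)) -> positive (place sigma (n1 ++ n2))].
Proof.
case/productive_choose => n [/der_split[t1 [t2 [E D1 D2]]] P R].
have [n1 [n2 [En E1 E2]]] := map_eq_cat E; exists n1, n2.
by rewrite -En -/(place _ _) in P R *; rewrite /place E1 E2.
Qed.

(** [m] and [m'] gather the side branches, and the end of a stopped path, each reduced to letters
    placed on [sigma]. If [k] is positive, some counted edge has a positive sibling, and the
    reduction can preserve this. *)
Lemma seg_der sigma psi X Y k : seg sigma psi X Y k -> exists m m',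
  [/\ der [:: inr (X, psi)] (place [::] m ++ hole [::] Y ++ place [::] m'),
      productive (place sigma (m ++ m')) &
      0 < k -> positive (place sigma (m ++ m'))].
Proof.
elim=> {sigma psi X Y k}.
- move=> sigma X; exists [::], [::]; split=> //; first exact: der_refl.
  by exists [::]; apply: der_nil.
- move=> sigma psi X P; have [n [D Pn _]] := @productive_choose sigma [:: inr (X, psi)] P.
  by exists n, [::]; rewrite !cats0; split.
- move=> sigma f psi X Z Y k1 k2 _ [m1 [m1' [D1 P1 R1]]] _ [m2 [m2' [D2 P2 R2]]].
  rewrite -lift_place place_cat in P1 R1.
  have [n1 [n2 [E1 E2 Pn Rn]]] := choose_pair P1.
  exists (n1 ++ m2), (m2' ++ n2); split.
  + apply: (@der_trans _ (lift psi (place [::] m1 ++ hole [::] (Some Z) ++ place [::] m1'))).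
      exact: (der_lift psi D1).
    rewrite !lift_cat lift_hole !lift_place !place_cat -!catA; apply: der_cat E1 _.
    by rewrite !catA; apply: der_cat E2; rewrite -!catA.
  + apply: (@eq_productive _ ((n1 ++ n2) ++ (m2 ++ m2'))).
      by move=> c; rewrite !mem_cat; do !case: (_ \in _).
    by rewrite place_cat productive_cat.
  + move=> k0; apply: (@eq_positive _ ((n1 ++ n2) ++ (m2 ++ m2'))).
      by move=> c; rewrite !mem_cat; do !case: (_ \in _).
    rewrite place_cat positive_cat; split=> //.
    case: k1 k0 R1 => [|k1] k0 R1; first by right; apply: R2.
    by left; apply: Rn; apply: R1.
- move=> sigma f psi X k _ [m [m' [D P R]]].
  rewrite /= -place_cat in D.
  have [n [E Pn Rn]] : exists n, [/\ der (lift psi (place [::] (m ++ m'))) (place [::] n),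
      productive (place sigma n) & positive (lift sigma (lift psi (place [::] (m ++ m')))) -> positive (place sigma n)].
    by apply: productive_choose; rewrite lift_lift lift_place.
  rewrite lift_lift lift_place in Rn.
  exists n, [::]; rewrite !cats0; split=> //; last by move/R/Rn.
  exact: der_trans (der_lift psi D) E.
- move=> sigma f X l Z psi r Y k E P _ [m [m' [D Pm Rm]]].
  have [n1 [n2 [E1 E2 Pn Rn]]] := choose_pair P.
  exists (n1 ++ m), (m' ++ n2); split.
  + apply: der_edge E _; rewrite !place_cat -!catA; apply: der_cat E1 _.
    by rewrite !catA -cat1s; apply: der_cat E2; rewrite -!catA.
  + apply: (@eq_productive _ ((n1 ++ n2) ++ (m ++ m'))).
      by move=> c; rewrite !mem_cat; do !case: (_ \in _).
    by rewrite place_cat productive_cat.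
  + move=> k0; apply: (@eq_positive _ ((n1 ++ n2) ++ (m ++ m'))).
      by move=> c; rewrite !mem_cat; do !case: (_ \in _).
    rewrite place_cat positive_cat; split=> //.
    case: truthP k0 => [/Rn ? _|_]; first by left.
    by rewrite addn0 => /Rm; right.
Qed.

(* A piece of a path between [(X0, f0 :: sigma)] and its later state
   [(Y0, sigma)], with a gap from [(X, xi ++ sigma)] to [(Y, rho ++ sigma)].
   Everything off the path is a word over letters that are productive on
   [sigma]; [b] implies that such a word can yield something nonempty. *)
Definition nest sigma X0 f0 Y0 xi X rho Y (b : Prop) := exists u v p q : seq letter,
  [/\ der [:: inr (X0, [:: f0])] (place [::] u ++ inr (X, xi) :: place [::] v),
      der (hole rho Y) (place [::] p ++ hole [::] Y0 ++ place [::] q),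
      productive (place sigma (u ++ v ++ p ++ q)) &
      b -> positive (place sigma (u ++ v ++ p ++ q))].

(** The part before the gap is prolonged; the new side branches, reduced to letters on [sigma], join
    [u] and [v]. *)
Lemma nest_up sigma X0 f0 Y0 xi X rho Y b s1 X' xi' s2 :
  nest sigma X0 f0 Y0 xi X rho Y b ->
  der [:: inr (X, xi)] (s1 ++ inr (X', xi') :: s2) -> productive (lift sigma (s1 ++ s2)) ->
  nest sigma X0 f0 Y0 xi' X' rho Y (b \/ positive (lift sigma (s1 ++ s2))).
Proof.
case=> u [v [p [q [Du Dp P R]]]] D Ps; have [n1 [n2 [E1 E2 Pn Rn]]] := choose_pair Ps.
have Emem : (u ++ v ++ p ++ q) ++ (n1 ++ n2) =i (u ++ n1) ++ (n2 ++ v) ++ p ++ q.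
  by move=> c; rewrite !mem_cat; do !case: (_ \in _).
exists (u ++ n1), (n2 ++ v), p, q; split=> //.
- apply: der_trans Du _; rewrite !place_cat.
  have -> : (place [::] u ++ place [::] n1) ++ inr (X', xi') :: place [::] n2 ++ place [::] v =
      place [::] u ++ (place [::] n1 ++ [:: inr (X', xi')] ++ place [::] n2) ++ place [::] v.
    by rewrite -!catA.
  apply: (@der_middle [:: _]); apply: der_trans D _.
  exact: der_cat E1 (der_cat (der_refl [:: _]) E2).
- by apply: eq_productive Emem _; rewrite place_cat productive_cat.
- move=> H; apply: eq_positive Emem _; rewrite place_cat positive_cat; split=> //.
  by case: H => [/R|/Rn]; [left|right].
Qed.

(** The part after the gap is prolonged backwards; the new side branches join [p] and [q]. *)
Lemma nest_down sigma X0 f0 Y0 xi X rho Y b s1 Y' rho' s2 :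
  nest sigma X0 f0 Y0 xi X rho Y b ->
  der (hole rho' Y') (s1 ++ hole rho Y ++ s2) -> productive (lift sigma (s1 ++ s2)) ->
  nest sigma X0 f0 Y0 xi X rho' Y' (b \/ positive (lift sigma (s1 ++ s2))).
Proof.
case=> u [v [p [q [Du Dp P R]]]] D Ps; have [n1 [n2 [E1 E2 Pn Rn]]] := choose_pair Ps.
have Emem : (u ++ v ++ p ++ q) ++ (n1 ++ n2) =i u ++ v ++ (n1 ++ p) ++ (q ++ n2).
  by move=> c; rewrite !mem_cat; do !case: (_ \in _).
exists u, v, (n1 ++ p), (q ++ n2); split=> //.
- apply: der_trans D _; rewrite !place_cat -catA.
  apply: der_cat E1 _; rewrite !catA; apply: der_cat E2; rewrite -!catA //.
- by apply: eq_productive Emem _; rewrite place_cat productive_cat.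
- move=> H; apply: eq_positive Emem _; rewrite place_cat positive_cat; split=> //.
  by case: H => [/R|/Rn]; [left|right].
Qed.

Lemma nest_weaken sigma X0 f0 Y0 xi X rho Y (b b' : Prop) : (b' -> b) ->
  nest sigma X0 f0 Y0 xi X rho Y b -> nest sigma X0 f0 Y0 xi X rho Y b'.
Proof. by move=> I [u [v [p [q [Du Dp P R]]]]]; exists u, v, p, q; split=> // /I. Qed.

Lemma nest_refl sigma X f Y : nest sigma X f Y [:: f] X [::] Y False.
Proof.
exists [::], [::], [::], [::]; split=> //.
- exact: der_refl.
- by rewrite cats0; apply: der_refl.
- by exists [::]; apply: der_nil.
Qed.

Lemma nest_ty sigma tau X0 f0 Y0 xi X rho Y b : ty sigma = ty tau ->
  nest sigma X0 f0 Y0 xi X rho Y b -> nest tau X0 f0 Y0 xi X rho Y b.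
Proof.
move=> E [u [v [p [q [Du Dp P R]]]]]; exists u, v, p, q; split=> //.
  exact: ty_productive P.
by move=> /R; apply: ty_positive.
Qed.

Lemma nest_trans sigma X0 f0 Y0 X1 f1 rho Y1 b xi X rho' Y b' :
  nest sigma X0 f0 Y0 (f1 :: rho) X1 rho Y1 b ->
  nest (rho ++ sigma) X1 f1 Y1 xi X rho' Y b' ->
  nest sigma X0 f0 Y0 (xi ++ rho) X (rho' ++ rho) Y (b \/ b').
Proof.
move=> N1 [u [v [p [q [Du Dp P R]]]]].
have {}Du := der_lift rho Du; rewrite lift_cat /= -!/(lift _ _) !lift_place in Du.
have {}Dp := der_lift rho Dp; rewrite !lift_cat !lift_hole !lift_place in Dp.
rewrite catA place_cat productive_cat positive_cat in P R; case: P => Pu Pp.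
have Lu : lift sigma (place rho u ++ place rho v) = place (rho ++ sigma) (u ++ v).
  by rewrite -place_cat lift_place.
have Lp : lift sigma (place rho p ++ place rho q) = place (rho ++ sigma) (p ++ q).
  by rewrite -place_cat lift_place.
have {N1} := nest_up N1 Du; rewrite Lu => /(_ Pu) N2.
have {N2} := nest_down N2 Dp; rewrite Lp => /(_ Pp).
by apply: nest_weaken => -[|/R[_ _ []]]; tauto.
Qed.

(** * Reachability between quadruples and the existence of a positive loop *)

Definition quad : Type := (N * F * option N * {ffun N -> bool * bool})%type.

(** One [rho] serves every stack of profile [t], so that a loop can be repeated with the same [rho]
    at each level. *)
Definition reach (x y : quad) (b : Prop) :=
  let: (X, f, Y, t) := x in let: (X', f', Y', t') := y in
  exists rho, forall sigma, ty sigma = t ->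
    ty (rho ++ sigma) = t' /\ nest sigma X f Y (f' :: rho) X' rho Y' b.

Lemma reachI sigma rho X f Y X' f' Y' b :
  nest sigma X f Y (f' :: rho) X' rho Y' b ->
  reach (X, f, Y, ty sigma) (X', f', Y', ty (rho ++ sigma)) b.
Proof.
move=> D; exists rho => tau E; split; first exact: ty_cat.
by apply: nest_ty D.
Qed.

Lemma reach_refl x : reach x x False.
Proof. by case: x => -[[X f] Y] t; exists [::] => sigma E; split=> //; apply: nest_refl. Qed.

Lemma reach_trans x y z b b' : reach x y b -> reach y z b' -> reach x z (b \/ b').
Proof.
case: x y z => [[[X f] Y] t] [[[X' f'] Y'] t'] [[[X2 f2] Y2] t2] [rho P] [rho' Q].
exists (rho' ++ rho) => sigma /P[/Q[E2 N2] N1]; split; first by rewrite -catA.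
exact: nest_trans N1 N2.
Qed.

Lemma reach_weaken x y (b b' : Prop) : (b' -> b) -> reach x y b -> reach x y b'.
Proof.
case: x y => [[[X f] Y] t] [[[X' f'] Y'] t'] I [rho P]; exists rho => sigma /P[E D].
by split=> //; apply: nest_weaken D.
Qed.

Definition heavy (x : quad) := let: (X, f, Y, t) := x in
  forall K, exists sigma k, [/\ ty sigma = t, K <= k & seg sigma [:: f] X Y k].

Lemma not_heavy_bound : exists B0, forall sigma X f Y k,
  ~ heavy (X, f, Y, ty sigma) -> seg sigma [:: f] X Y k -> k <= B0.
Proof.
have /fin_all_exists [B P] : forall x : quad, exists B0, ~ heavy x ->
    let: (X, f, Y, t) := x in
    forall sigma k, ty sigma = t -> seg sigma [:: f] X Y k -> k <= B0.
  case=> -[[X f] Y] t; have [|h] := classic (heavy (X, f, Y, t)); first by exists 0.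
  apply: NNPP => nB; apply: (h) => K; apply: NNPP => nK; apply: nB; exists K => _ sigma k E S.
  by rewrite leqNgt; apply/negP => lt; apply: nK; exists sigma, k; rewrite ltnW.
exists (\max_x B x) => sigma X f Y k h S.
apply: leq_trans (leq_bigmax (X, f, Y, ty sigma)); exact: (P _ h).
Qed.

Lemma bounded_list (T : Type) (m : T -> nat) (l : seq T) :
  exists C, forall x, List.In x l -> m x <= C.
Proof.
elim: l => [|x l [C P]]; first by exists 0.
by exists (maxn (m x) C) => y [<-|/P ?]; rewrite leq_max ?leqnn // orbC; apply/orP; left.
Qed.

(** [C] bounds both the branching and the number of flags pushed by an edge. It exceeds 1 so that
    its powers increase strictly. *)
Lemma edge_bound : exists C, 1 < C /\ forall X xi s, edge X xi s ->
  size s <= C /\ forall l Z psi r, s = l ++ inr (Z, psi) :: r -> size psi <= C + size xi.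
Proof.
pose flags (c : rhs_sym N F A) := if c is RNT _ psi then size psi else 0.
have [C1 P1] := bounded_list (fun x => size x.2) (ig_prods G).
have [C2 P2] := bounded_list (fun x => sumn (map flags x.2)) (ig_prods G).
have [C3 P3] := bounded_list (fun x => size x.2) (ig_flag_prods G).
exists (C1 + C2 + C3).+2; split=> // X xi s.
case=> [[rhs [i ->]]|[f [xi' [rhs [-> [i ->]]]]]]; rewrite size_map.
  split; first by have := P1 _ i; rewrite /=; lia.
  move=> l Z psi r /map_eq_cat[l' [cr [E _ Er]]].
  case: cr E Er => [//|[//|Z' psi'] r'] E /= [_ Epsi _].
  have /= := P2 _ i; rewrite E map_cat sumn_cat /= -Epsi size_cat; lia.
split; first by have := P3 _ i; rewrite /=; lia.
move=> l Z psi r /map_eq_cat[l' [cr [E _ Er]]].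
case: cr E Er => [//|[Z'|//] r'] E /= [_ Epsi _]; rewrite -Epsi; lia.
Qed.

(* If no cycle through [(X0, f0, Y0)] is positive, then a side branch of a heavy nested
   segment cannot contribute, so all segments nested there have bounded weight. *)
Lemma seg_bound B0 C X0 f0 Y0 sigma0 :
  (forall sigma X f Y k, ~ heavy (X, f, Y, ty sigma) -> seg sigma [:: f] X Y k -> k <= B0) ->
  (forall X xi s, edge X xi s ->
    size s <= C /\ forall l Z psi r, s = l ++ inr (Z, psi) :: r -> size psi <= C + size xi) ->
  (forall y, heavy y -> reach (X0, f0, Y0, ty sigma0) y False ->
     reach y (X0, f0, Y0, ty sigma0) False) ->
  ~ reach (X0, f0, Y0, ty sigma0) (X0, f0, Y0, ty sigma0) True ->
  forall sigma psi X Y k, seg sigma psi X Y k ->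
  forall rho b, sigma = rho ++ sigma0 ->
  nest sigma0 X0 f0 Y0 (psi ++ rho) X rho Y b ->
  k <= size psi * B0 \/ (k <= (C.+1 * B0).+1 /\ ~ b).
Proof.
move=> PB PC back noloop sigma psi X Y k; elim=> {sigma psi X Y k}.
- by move=> *; left.
- by move=> *; left.
- move=> sigma f psi X Z Y k1 k2 S1 IH1 S2 IH2 rho b Es D; subst sigma.
  have [m1 [m1' [D1 P1 R1]]] := seg_der S1.
  have [m2 [m2' [D2 P2 R2]]] := seg_der S2.
  (* Each of the two pieces counts as a side contribution for the other. Hence, if one of them falls
     under the second alternative, the other has weight 0. *)
  have {IH1} I1 : k1 <= 1 * B0 \/ (k1 <= (C.+1 * B0).+1 /\ ~ (b \/ 0 < k2)).
    apply: (IH1 (psi ++ rho)); first by rewrite catA.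
    have {}D2 := der_lift rho D2; rewrite !lift_cat !lift_hole !lift_place in D2.
    have L : lift sigma0 (place rho m2 ++ place rho m2') = place (rho ++ sigma0) (m2 ++ m2').
      by rewrite -place_cat lift_place.
    have := @nest_down _ _ _ _ _ _ _ _ _ _ (Some Z) _ _ D D2; rewrite L => /(_ P2).
    apply: nest_weaken; tauto.
  have {IH2} I2 : k2 <= size psi * B0 \/ (k2 <= (C.+1 * B0).+1 /\ ~ (b \/ 0 < k1)).
    apply: IH2 (erefl _) _.
    have {}D1 := der_lift (psi ++ rho) D1; rewrite !lift_cat lift_hole !lift_place in D1.
    have L : lift sigma0 (place (psi ++ rho) m1 ++ place (psi ++ rho) m1') =
        place (psi ++ rho ++ sigma0) (m1 ++ m1').
      by rewrite -place_cat lift_place catA.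
    have := nest_up D D1; rewrite L => /(_ P1).
    apply: nest_weaken; tauto.
  rewrite /= mulSn; case: I1 => [I1|[I1 nI1]].
    case: I2 => [I2|[I2 nI2]]; first by left; lia.
    right; split; last by tauto.
    by case: k1 nI2 {S1 R1 I1} => [|k1] nI2 //; case: nI2; right.
  right; split; last by tauto.
  by case: k2 nI1 {S2 R2 I2} => [|k2] nI1; [rewrite addn0|case: nI1; right].
- move=> sigma f psi X k S IH rho b Es D; subst sigma.
  case: (IH (psi ++ rho) b (catA _ _ _) D) => [I|I]; [left|by right].
  by move: I; rewrite /= mulSn; lia.
- move=> sigma f X l Z psi r Y k E P S IH rho b Es D; subst sigma.
  have S' := seg_step E P S.
  have [h|h] := classic (heavy (X, f, Y, ty (rho ++ sigma0))); last first.
    by left; rewrite mul1n; apply: PB h S'.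
  have R1 := reachI D.
  (* A heavy quadruple leads back to the initial one by [back], so [b] would close a positive
     loop. *)
  have nb : ~ b.
    move=> hb; apply: noloop; apply: reach_weaken (reach_trans R1 (back _ h _)).
      by left.
    exact: reach_weaken R1.
  right; split=> //.
  have {}E1 := edge_lift rho E.
  have {E1} D1 : der [:: inr (X, [:: f] ++ rho)] (lift rho l ++ inr (Z, psi ++ rho) :: lift rho r).
    by apply: der_edge E1 _; rewrite lift_cat; apply: der_refl.
  have := nest_up D D1; rewrite -lift_cat lift_lift => /(_ P) D2.
  (* The rest of the path pops at most [C.+1] flags. Under the first alternative its weight is at
     most [C.+1 * B0] and this edge adds at most 1; under the second, the siblings of this edge
     cannot be positive, so it adds nothing. *)
  have [|[le nR]] := IH rho _ (erefl _) D2.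
    have [_ /(_ _ _ _ _ (erefl _))] := PC _ _ _ E; rewrite addn1 => le1 le2.
    have : k <= C.+1 * B0 by apply: leq_trans le2 (leq_mul le1 (leqnn _)).
    by case: (truth _); lia.
  by case: truthP => R; [case: nR; right|rewrite addn0].
Qed.

Lemma heavy_positive_loop S f0 : heavy (S, f0, None, ty [::]) ->
  exists x, [/\ heavy x, reach (S, f0, None, ty [::]) x False & reach x x True].
Proof.
set s := (_, _, _, _) => hs.
pose Rset (x : quad) := [set y : quad | truth (heavy y /\ reach x y False)].
have Rtr x y : y \in Rset x -> Rset y \subset Rset x.
  rewrite inE => /truthP[_ R1]; apply/subsetP => z; rewrite !inE => /truthP[h R2].
  by apply/truthP; split=> //; apply: reach_weaken (reach_trans R1 R2); tauto.
have ss : s \in Rset s by rewrite inE; apply/truthP; split=> //; apply: reach_refl.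
(* With as few heavy quadruples reachable from [x] as possible, each of them reaches the same set,
   hence reaches [x] again. *)
case: (@arg_minnP _ s (fun x => x \in Rset s) (fun x => #|Rset x|) ss) => x xs xmin.
move: (xs); rewrite inE => /truthP[hx Rx].
exists x; split=> //; apply: NNPP => noloop.
have xx : x \in Rset x by rewrite inE; apply/truthP; split=> //; apply: reach_refl.
have back y : heavy y -> reach x y False -> reach y x False.
  move=> hy Ry; have yx : y \in Rset x by rewrite inE; apply/truthP.
  have ys : y \in Rset s by apply: (subsetP (Rtr _ _ xs)).
  have /eqP E : Rset y == Rset x by rewrite eqEcard Rtr //= xmin.
  by move: xx; rewrite -E inE => /truthP[].
have [B0 PB] := not_heavy_bound; have [C [_ PC]] := edge_bound.
case: x hx back noloop {xs xmin Rx xx} => -[[X f] Y] t hx back noloop.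
(* The weight is taken above both bounds offered by [seg_bound] for a stack of one flag. *)
have [sigma [k [Et lek Sk]]] := hx ((C.+1 * B0).+1 + B0).+1; subst t.
have := seg_bound PB PC back noloop Sk (rho := [::]) (erefl _) (nest_refl _ _ _ _).
by rewrite mul1n; case=> [|[]]; lia.
Qed.

(** The path follows a symbol [c] whose yield has at least average length. A counted edge divides
    the length by at most [C]; any other edge has siblings with empty yield and preserves it. As
    [f0] is never popped, the stacks on the path are never empty. *)
Lemma long_path f0 : (forall X rhs, ~ List.In (f0, X, rhs) (ig_flag_prods G)) ->
  forall C, 1 < C -> (forall X xi s, edge X xi s -> size s <= C) ->
  forall s w, der (lift [:: f0] s) (term w) -> w <> [::] ->
  exists l c r wl wc wr,
    [/\ lift [:: f0] s = l ++ c :: r, w = wl ++ wc ++ wr,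
        der l (term wl), der r (term wr) & size w <= size s * size wc] /\
    match c with
    | inl _ => size wc = 1
    | inr (X, xi) => exists k, seg [::] xi X None k /\ size wc <= C ^ k.+1
    end.
Proof.
move=> nof C C1 PC s w.
move Et: (lift _ s) => t; move Eu: (term w) => u D.
elim: D s w Et Eu => {t u} [|c t u D IH|X xi r t u1 u2 E D1 IH1 D2 IH2] [|d s] w //=.
- by case: w.
- case: w => // a w [Ed Et] [Ec Eu] _; subst c u; rewrite -Ec.
  have [Ew|wN] : w = [::] \/ w <> [::] by case: (w); [left|right].
    subst w; exists [::], (inl a), t, [::], [:: a], [::]; do !split=> //; exact: der_nil.
  have [l [c [r [wl [wc [wr [[E1 E2 Dl Dr le] Pc]]]]]]] := IH _ _ Et erefl wN.
  exists (inl a :: l), c, r, (a :: wl), wc, wr; do !split=> //.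
  + by rewrite E1.
  + by rewrite E2.
  + exact: der_keep.
  + have : 0 < size wc by case: (wc) le => //=; rewrite muln0; case: (w) wN.
    by rewrite /= mulSn; lia.
- case: d => // -[Y xi0] [_ Exi Et] Eu wN.
  have [w1 [w2 [Ew Ew1 Ew2]]] := map_eq_cat Eu.
  have [r' Er] : exists r', lift [:: f0] r' = r.
    case: xi0 Exi => [|f psi] Exi; last first.
      by rewrite -Exi in E; have [r' [-> _]] := edge_unlift E; exists r'.
    case: E => [[rhs [i ->]]|[f [xi' [rhs [Ef [i _]]]]]]; last first.
      by rewrite -Exi /= in Ef; case: Ef i => <- _ /nof.
    exists (map (@inst_prod A G [::]) rhs); rewrite -Exi /lift -map_comp.
    by apply: eq_map => -[a|Z psi] //=; rewrite cats0.
  have Sr : size r' = size r by rewrite -Er size_map.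
  have [k [Sk lek]] : exists k, seg [::] xi X None k /\ size w1 <= C ^ k.+1.
    have PX : seg [::] xi X None 0.
      by apply: seg_stop; exists w1; rewrite cats0; apply: der_edge E _; rewrite /term Ew1.
    (* A short yield ends the path at once with weight 0, which accounts for the [+1] in the
       exponent. *)
    have [le|gt] := leqP (size w1) C; first by exists 0; rewrite expn1.
    have w1N : w1 <> [::] by case: (w1) gt.
    have [l [c [r0 [wl [wc [wr [[E1 E2 Dl Dr le] Pc]]]]]]] := IH1 _ _ Er Ew1 w1N.
    have leC : size w1 <= C * size wc.
      by apply: leq_trans le _; rewrite Sr leq_mul2r (PC _ _ _ E) orbT.
    case: c E1 Pc => [a|[Z psi]] E1; first by move=> E3; rewrite E3 muln1 leqNgt gt in leC.
    case=> k [Sk lek].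
    have Plr : productive (lift [::] (l ++ r0)).
      by rewrite lift_nil productive_cat; split; [exists wl|exists wr].
    have [f [xi' Ef]] : exists f xi', xi = f :: xi'.
      by rewrite -Exi; case: (xi0) => [|f psi']; [exists f0, [::]|exists f, (psi' ++ [:: f0])].
    rewrite E1 Ef in E; exists (k + truth (positive (lift [::] (l ++ r0)))); split.
      by rewrite Ef; apply: seg_edge E Plr Sk.
    case: truthP => R; first by rewrite addn1 expnS; apply: leq_trans leC _; rewrite leq_mul2l lek orbT.
    suff [wl0 wr0] : wl = [::] /\ wr = [::] by rewrite E2 wl0 wr0 cats0 addn0.
    rewrite lift_nil positive_cat in R.
    split; apply: NNPP => wN'; apply: R; split; try by [exists wl|exists wr].
      by left; exists wl.
    by right; exists wr.
  have [Ew2'|w2N] : w2 = [::] \/ w2 <> [::] by case: (w2); [left|right].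
    exists [::], (inr (X, xi)), t, [::], w1, [::]; do !split=> //=; last by exists k.
    + by rewrite Ew Ew2'.
    + exact: der_nil.
    + by rewrite -Ew2 Ew2' in D2.
    + by rewrite Ew Ew2' cats0; nia.
  have [l [c [r0 [wl [wc [wr [[E1 E2 Dl Dr le] Pc]]]]]]] := IH2 _ _ Et Ew2 w2N.
  have [le12|lt21] := leqP (size wc) (size w1).
    exists [::], (inr (X, xi)), t, [::], w1, w2; do !split=> //=; last by exists k.
    + exact: der_nil.
    + by rewrite /term Ew2.
    + by rewrite Ew size_cat mulSn leq_add2l; apply: leq_trans le _; rewrite leq_mul2l le12 orbT.
  exists (inr (X, xi) :: l), c, r0, (w1 ++ wl), wc, wr; do !split=> //=.
  + by rewrite E1.
  + by rewrite Ew E2 -catA.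
  + by rewrite /term map_cat; apply: der_step E _ Dl; rewrite Ew1.
  + by rewrite Ew size_cat mulSn; lia.
Qed.

Lemma heavy_start S f0 : (forall X rhs, ~ List.In (f0, X, rhs) (ig_flag_prods G)) ->
  (forall K, exists w, K <= size w /\ der [:: inr (S, [:: f0])] (term w)) ->
  heavy (S, f0, None, ty [::]).
Proof.
move=> nof inf K; have [C [C1 PC]] := edge_bound.
have [w [lew D]] := inf (C ^ K.+1).+1.
have wN : w <> [::] by case: (w) lew.
have PC' X xi s : edge X xi s -> size s <= C by case/PC.
have [l [c [r [wl [wc [wr [[E _ _ _ le] Pc]]]]]]] :=
  long_path nof C1 PC' (s := [:: inr (S, [::])]) D wN.
have [l0 r0 Ec] : [/\ l = [::], r = [::] & c = inr (S, [:: f0])].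
  by case: l E => [[-> ->]|? [|? ?] []].
subst; case: Pc => k [Sk lek]; exists [::], k; split=> //.
rewrite mul1n in le.
have : C ^ K.+1 < C ^ k.+1 by apply: leq_trans lek; apply: leq_trans le.
by rewrite ltn_exp2l // ltnS => /ltnW.
Qed.
End Derivations.

(** * Pumped words *)

(** The mirror image of [series], namely [H^(n-1)(x) ... H(x) x], as produced by side branches that
    are met from right to left. *)
Fixpoint rseries (B : Type) (H : B -> seq B) (x : seq B) (n : nat) : seq B :=
  if n is n'.+1 then iter n' (morph_ext H) x ++ rseries H x n' else [::].

Lemma rseriesS (B : Type) (H : B -> seq B) x n :
  rseries H x n.+1 = iter n (morph_ext H) x ++ rseries H x n.
Proof. by []. Qed.

Lemma rseries_recr (B : Type) (H : B -> seq B) x n :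
  rseries H x n.+1 = morph_ext H (rseries H x n) ++ x.
Proof.
elim: n => [|n IH]; first by rewrite /= cats0.
by rewrite [in RHS]rseriesS rseriesS IH !morph_extE subst_cat catA.
Qed.

Lemma rseries_shift (B : Type) (H : B -> seq B) x n :
  rseries H x n.+1 = rseries H (morph_ext H x) n ++ x.
Proof.
elim: n => [|n IH]; first by rewrite /= cats0.
by rewrite rseriesS IH [in RHS]rseriesS iterSr catA.
Qed.

Lemma size_series (B : Type) (H : B -> seq B) x n :
  (forall b, H b <> [::]) -> x <> [::] -> n <= size (series H x n).
Proof.
move=> HN xN; elim: n => // n IH; rewrite seriesS size_cat.
by case: (iter n _ x) (iter_morph_neq0 (n := n) HN xN) => //= c s _; lia.
Qed.

Lemma size_rseries (B : Type) (H : B -> seq B) x n :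
  (forall b, H b <> [::]) -> x <> [::] -> n <= size (rseries H x n).
Proof.
move=> HN xN; elim: n => // n IH; rewrite /= size_cat.
by case: (iter n _ x) (iter_morph_neq0 (n := n) HN xN) => //= c s _; lia.
Qed.

(** [x] and [y] surround the entrance into the loop, [u] and [v] the descents that push, [m] and
    [m'] the passage from pushing to popping, [p] and [q] the returns that pop, and [z] is the end.
    A letter on the [i]-fold pumped stack contributes [g(H^i(letter))]. *)
Definition pump_word (A B : Type) (H : B -> seq B) (g : B -> seq A)
  (u m p q m' v : seq B) (x y z : seq A) n : seq A :=
  x ++ subst g (series H u n) ++ subst g (iter n (morph_ext H) m) ++
  subst g (rseries H p n) ++ z ++ subst g (series H q n) ++
  subst g (iter n (morph_ext H) m') ++ subst g (rseries H v n) ++ y.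

(** * Infinite words with pumped words as prefixes are morphic *)

Section PumpedWords.
Variables (A B : finType) (H : B -> seq B) (g : B -> seq A).
Variables (u m p q m' v : seq B) (x y z : seq A) (alpha : nat -> A).
Hypothesis HN : forall b, H b <> [::].
Hypothesis gN : forall b, g b <> [::].
Hypothesis someN : u ++ v ++ p ++ q <> [::].
Hypothesis pref : forall n, is_prefix (pump_word H g u m p q m' v x y z n) alpha.

(* A letter [inr (d, i)] of the enlarged alphabet stands for a growing product:
   [d] tells whether it grows to the right (as for u and q) or to the left. *)
Let B' : finType := (A + B + bool * bool)%type.
Let omega (k : bool * bool) : seq B :=
  match k with (true, true) => u | (true, false) => q | (false, true) => p | _ => v end.
Let inA (w : seq A) : seq B' := map (inl \o inl) w.
Let inB (s : seq B) : seq B' := map (inl \o inr) s.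
Let H' (c : B') : seq B' :=
  match c with
  | inl (inl a) => [:: c]
  | inl (inr b) => inB (H b)
  | inr k => if k.1 then c :: inB (morph_ext H (omega k)) else rcons (inB (morph_ext H (omega k))) c
  end.
(** A growing letter itself stands for the factor [omega k], so [n] iterations give [n.+1] factors.
    The value [alpha 0] keeps [g'] nonerasing when [omega k] is empty. *)
Let g' (c : B') : seq A :=
  match c with
  | inl (inl a) => [:: a]
  | inl (inr b) => g b
  | inr k => if omega k is [::] then [:: alpha 0] else subst g (omega k)
  end.
Let E k : seq B' := if omega k is [::] then [::] else [:: inr k].
(** The starting word represents the pumped word for [n = 1]: one factor in each product, and [H]
    applied once to [m] and [m']. *)
Let W : seq B' := inA x ++ E (true, true) ++ inB (morph_ext H m) ++ E (false, true) ++
  inA z ++ E (true, false) ++ inB (morph_ext H m') ++ E (false, false) ++ inA y.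

Let MB s : morph_ext H' (inB s) = inB (morph_ext H s).
Proof. by rewrite !morph_extE /inB map_subst subst_map. Qed.

Let iterB n s : iter n (morph_ext H') (inB s) = inB (iter n (morph_ext H) s).
Proof. by elim: n => //= n ->; rewrite MB. Qed.

Let iterA n w : iter n (morph_ext H') (inA w) = inA w.
Proof. by elim: n => //= n ->; rewrite morph_extE /inA subst_map; elim: w => //= a w; rewrite subst_cons => ->. Qed.

Let gB s : subst g' (inB s) = subst g s.
Proof. by rewrite /inB subst_map. Qed.

Let gA w : subst g' (inA w) = w.
Proof. by rewrite /inA subst_map; apply: subst_pure. Qed.

Let iterR n i : omega (true, i) <> [::] -> iter n (morph_ext H') (E (true, i)) =
  inr (true, i) :: inB (series H (morph_ext H (omega (true, i))) n).
Proof.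
move=> oN; have -> : E (true, i) = [:: inr (true, i)] by rewrite /E; case: (omega _) oN.
elim: n => //= n ->; rewrite morph_extE subst_cons -morph_extE MB series_recl.
by rewrite /inB map_cat.
Qed.

Let iterL n i : omega (false, i) <> [::] -> iter n (morph_ext H') (E (false, i)) =
  rcons (inB (rseries H (morph_ext H (omega (false, i))) n)) (inr (false, i)).
Proof.
move=> oN; have -> : E (false, i) = [:: inr (false, i)] by rewrite /E; case: (omega _) oN.
elim: n => // n IH; rewrite iterS IH -cats1 morph_extE subst_cat subst_seq1 -morph_extE MB.
by rewrite rseries_recr /inB map_cat rcons_cat.
Qed.

Let g'inr k : omega k <> [::] -> g' (inr k) = subst g (omega k).
Proof. by rewrite /g'; case: (omega k). Qed.

Let E0 k n : omega k = [::] -> iter n (morph_ext H') (E k) = [::].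
Proof. by rewrite /E => ->; apply: iter_morph_nil. Qed.

Let nilP (T : Type) (s : seq T) : s = [::] \/ s <> [::].
Proof. by case: s; [left|right]. Qed.

Let gR n i : subst g' (iter n (morph_ext H') (E (true, i))) =
  subst g (series H (omega (true, i)) n.+1).
Proof.
case: (nilP (omega (true, i))) => [o0|oN].
  rewrite E0 // o0; suff -> : series H [::] n.+1 = [::] by [].
  by elim: n.+1 => // k IHk; rewrite seriesS IHk iter_morph_nil.
by rewrite iterR // subst_cons gB g'inr // series_shift subst_cat.
Qed.

Let gL n i : subst g' (iter n (morph_ext H') (E (false, i))) =
  subst g (rseries H (omega (false, i)) n.+1).
Proof.
case: (nilP (omega (false, i))) => [o0|oN].
  rewrite E0 // o0; suff -> : rseries H [::] n.+1 = [::] by [].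
  by elim: n.+1 => // k IHk; rewrite [LHS]/= iter_morph_nil.
by rewrite iterL // -cats1 subst_cat gB subst_seq1 g'inr // rseries_shift subst_cat.
Qed.

Let size_E n k : omega k <> [::] -> n <= size (iter n (morph_ext H') (E k)).
Proof.
have MN s : s <> [::] -> morph_ext H s <> [::] by apply: subst_neq0.
case: k => -[] i oN; rewrite ?iterR ?iterL //= ?size_rcons size_map.
  by apply: leq_trans (leqnSn _); apply: size_series => //; apply: MN.
by apply: leq_trans (leqnSn _); apply: size_rseries => //; apply: MN.
Qed.

Lemma morphic_pumped : morphic alpha.
Proof.
apply: (@morphic_D0L B' H' _ A alpha g' W).
- case=> [[a|b]|[[] i]] //=; last by case: (inB _).
  by case: (H b) (@HN b).
- case=> [[a|b]|k] //=.
  case: (nilP (omega k)) => [->|oN] //; rewrite -/(g' (inr k)) g'inr //.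
  exact: subst_neq0.
- move=> n; exists n; rewrite /W !iter_morph_cat !size_cat.
  have [k oN] : exists k, omega k <> [::].
    case: (nilP u) => [u0|]; last by exists (true, true).
    case: (nilP v) => [v0|]; last by exists (false, false).
    case: (nilP p) => [p0|]; last by exists (false, true).
    case: (nilP q) => [q0|]; last by exists (true, false).
    by case: someN; rewrite u0 v0 p0 q0.
  by have := size_E n oN; case: k oN => -[] [] _; lia.
- move=> n; suff -> : subst g' (iter n (morph_ext H') W) = pump_word H g u m p q m' v x y z n.+1 by [].
  rewrite /W !iter_morph_cat !(subst_cat g') gR gL gR gL !iterA !iterB !gA !gB.
  by rewrite -!iterSr.
Qed.
End PumpedWords.

(** * Pumping along a positive loop *)

Section Pumping.
Variables (A : finType) (G : indexed_grammar A).
Local Notation N := (ig_N G).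
Local Notation F := (ig_F G).
Local Notation letter := (A + N)%type.

Section Kept.
Variables (sigma0 rho : seq F) (a0 : A).
Hypothesis loop : ty (rho ++ sigma0) = ty sigma0.

Let st n := iter n (cat rho) sigma0.
Let kept (c : letter) := truth (positive [:: @place1 A G sigma0 c]).

Let ty_st n : ty (st n) = ty sigma0.
Proof. by elim: n => // n IH; rewrite -[RHS]loop; apply: ty_cat. Qed.

(** A productive letter that is not positive derives the empty word, so it may be erased. *)
Let der_kept sigma n : ty sigma = ty sigma0 -> productive (place sigma n) ->
  der (@place A G sigma n) (place sigma (filter kept n)).
Proof.
move=> Et; elim: n => [|c n IH] P; first exact: der_nil.
move: P; rewrite [place _ _]/= -cat1s productive_cat => -[[w Dw] /IH Dn].
rewrite /=; case: ifP => [_|/truthP nk]; first exact: der_keep.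
suff w0 : w = [::] by rewrite w0 in Dw; apply: (der_cat Dw Dn).
apply: NNPP => wN; apply: nk; apply: (ty_positive1 Et); by exists w.
Qed.

Let kept_neq0 n : positive (place sigma0 n) -> filter kept n <> [::].
Proof.
case/positive_placeP=> _ [c cn Pc] E.
by have : c \in filter kept n; [rewrite mem_filter cn andbT; apply/truthP|rewrite E].
Qed.

(** [H c] is what remains of [c] after one copy of [rho] is consumed, restricted to kept letters.
    That derivation does not look below [rho] and the profile is the same at all levels, so one [H]
    works throughout; [g] picks a nonempty yield on [sigma0]. *)
Lemma pump_morphism : exists (H : letter -> seq letter) (g : letter -> seq A),
  [/\ forall c, H c <> [::], forall c, g c <> [::] &
   forall n s, all kept s ->
     der (place (st n) s) (term G (subst g (iter n (morph_ext H) s)))].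
Proof.
have /fin_all_exists [H HP] : forall c : letter, exists n, n <> [::] /\ (kept c ->
    all kept n /\ forall k, der [:: place1 (st k.+1) c] (@place A G (st k) n)).
  (* Letters that are not kept get a dummy image, which keeps [H] nonerasing; [a0] does the same for
     [g]. *)
  move=> c; case kc: (kept c); last by exists [:: c].
  case: c kc => [a|Z] kc.
    exists [:: inl a]; split=> // _; split=> [|k]; first by rewrite /= kc.
    exact: der_refl.
  have /truthP/(ty_positive1 (esym loop)) P := kc.
  have [n [D Pn /(_ P) Rn]] := @productive_choose _ _ sigma0 [:: inr (Z, rho)] (positive_productive P).
  exists (filter kept n); split; first exact: kept_neq0.
  move=> _; split=> [|k]; first exact: filter_all.
  apply: der_trans (der_lift (st k) D) _; rewrite lift_place /=.
  by apply: der_kept => //; apply: ty_productive Pn.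
have /fin_all_exists [g gP] : forall c : letter, exists w, w <> [::] /\ (kept c ->
    der [:: place1 sigma0 c] (term G w)).
  move=> c; case: (truthP (positive [:: @place1 A G sigma0 c])) => [[w [wN D]]|nk].
    by exists w.
  by exists [:: a0]; split=> //; rewrite /kept => /truthP.
exists H, g; split=> [c|c|]; [by case: (HP c)|by case: (gP c)|].
elim=> [|n IH] s.
  elim: s => [|c s IHs] /=; first by move=> _; apply: der_nil.
  case/andP=> kc /IHs Ds; rewrite subst_cons /term map_cat -cat1s.
  by apply: der_cat Ds; apply: (gP c).2.
move=> ks; rewrite iterSr; suff [D ks'] : der (place (st n.+1) s) (place (st n) (morph_ext H s)) /\
    all kept (morph_ext H s) by apply: der_trans D (IH _ ks').
elim: s ks => [|c s IHs] /=; first by split=> //; apply: der_nil.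
case/andP=> kc /IHs[Ds ks]; have [kH DH] := (HP c).2 kc.
rewrite morph_extE subst_cons all_cat kH ks place_cat; split=> //.
exact: (der_cat (DH n) Ds).
Qed.

(** The loop is entered [n] times, pushing [rho] each time ([up]); then the passage through [m] and
    [m'] is inserted, and the [n] copies are popped again ([down]). *)
Lemma pump_family X f Y u v p q m m' (x y z : seq A) S f0 :
  der [:: inr (X, [:: f])] (place [::] u ++ inr (X, f :: rho) :: place [::] v) ->
  der (hole rho Y) (place [::] p ++ hole [::] Y ++ place [::] q) ->
  positive (place sigma0 (u ++ v ++ p ++ q)) ->
  der [:: inr (X, [:: f])] (place [::] m ++ hole [::] Y ++ place [::] m') ->
  productive (place sigma0 (m ++ m')) ->
  der [:: inr (S, [:: f0])] (term G x ++ inr (X, f :: sigma0) :: term G y) ->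
  der (hole sigma0 Y) (term G z) ->
  exists (H : letter -> seq letter) (g : letter -> seq A) (u m p q m' v : seq letter),
  [/\ forall c, H c <> [::], forall c, g c <> [::], u ++ v ++ p ++ q <> [::] &
   forall n, der [:: inr (S, [:: f0])] (term G (pump_word H g u m p q m' v x y z n))].
Proof.
move=> Du Dp R Dm Pm Ds Dz; have [H [g [HN gN DH]]] := pump_morphism.
pose k := filter kept.
exists H, g, (k u), (k m), (k p), (k q), (k m'), (k v); split=> //.
  by rewrite /k -!filter_cat; apply: kept_neq0.
have := positive_productive R.
rewrite !place_cat !productive_cat => -[Pu [Pv [Pp Pq]]].
move: Pm; rewrite place_cat productive_cat => -[Pm Pm'].
have D n s : productive (place sigma0 s) ->
    der (place (st n) s) (term G (subst g (iter n (morph_ext H) (k s)))).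
  move=> Ps; apply: der_trans (DH _ _ (filter_all _ _)).
  by apply: der_kept => //; apply: ty_productive Ps.
have up n : der [:: inr (S, [:: f0])]
    (term G (x ++ subst g (series H (k u) n)) ++ [:: inr (X, f :: st n)] ++
     term G (subst g (rseries H (k v) n) ++ y)).
  elim: n => [|n IH]; first by rewrite cats0.
  apply: der_trans IH _; rewrite seriesS [rseries _ _ _.+1]/= !subst_cat.
  have := der_lift (st n) Du; rewrite lift_cat /= -/(lift _ _) !lift_place => {}Du.
  have Dn : der [:: inr (X, f :: st n)] (term G (subst g (iter n (morph_ext H) (k u))) ++
      [:: inr (X, f :: st n.+1)] ++ term G (subst g (iter n (morph_ext H) (k v)))).
    apply: der_trans Du _; apply: der_cat (D _ _ Pu) _.
    exact: der_cat (der_refl [:: _]) (D _ _ Pv).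
  rewrite /term !map_cat -!catA; do 2!apply: der_cat (der_refl _) _.
  by have := der_middle [::] (term G (subst g (rseries H (k v) n) ++ y)) Dn; rewrite /term !map_cat -!catA.
have down n : der (hole (st n) Y)
    (term G (subst g (rseries H (k p) n) ++ z ++ subst g (series H (k q) n))).
  elim: n => [|n IH]; first by rewrite cats0.
  have := der_lift (st n) Dp; rewrite !lift_cat !lift_hole !lift_place => {}Dp.
  apply: der_trans Dp _; rewrite seriesS [rseries _ _ _.+1]/= !subst_cat.
  rewrite /term !map_cat -!catA; apply: der_cat (D _ _ Pp) _.
  rewrite !catA; apply: der_cat _ (D _ _ Pq).
  by move: IH; rewrite /term !map_cat !catA.
move=> n; apply: der_trans (up n) _.
have := der_lift (st n) Dm; rewrite !lift_cat lift_hole !lift_place => {}Dm.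
have Dn : der [:: inr (X, f :: st n)] (term G (subst g (iter n (morph_ext H) (k m))) ++
    term G (subst g (rseries H (k p) n) ++ z ++ subst g (series H (k q) n)) ++
    term G (subst g (iter n (morph_ext H) (k m')))).
  by apply: der_trans Dm _; apply: der_cat (D _ _ Pm) (der_cat (down n) (D _ _ Pm')).
rewrite /pump_word /term !map_cat -!catA; do 2!apply: der_cat (der_refl _) _.
by have := der_middle [::] (term G (subst g (rseries H (k v) n) ++ y)) Dn; rewrite /term !map_cat -!catA.
Qed.
End Kept.

Lemma morphic_of_derivations (S : N) f0 (alpha : nat -> A) :
  (forall X rhs, ~ List.In (f0, X, rhs) (ig_flag_prods G)) ->
  (forall K, exists w, K <= size w /\ der [:: inr (S, [:: f0])] (term G w)) ->
  (forall w, der [:: inr (S, [:: f0])] (term G w) -> is_prefix w alpha) ->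
  morphic alpha.
Proof.
move=> nof inf pref.
have [[[[X f] Y] t] [hx [rho0 R0] [rho R]]] := heavy_positive_loop (heavy_start nof inf).
have [Et [u0 [v0 [p0 [q0 [Du0 Dp0 P0 _]]]]]] := R0 [::] erefl; rewrite cats0 in Et.
move: P0; rewrite !place_cat !productive_cat => -[[x Dx] [[y Dy] [[z1 Dz1] [z2 Dz2]]]].
have [loop [u [v [p [q [Du Dp P Q]]]]]] := R _ Et.
(* Any segment can serve as the passage, so no weight is demanded; its side words carry over to
   [rho0] because the profiles agree. *)
have [sigma [k [Et' _ /seg_der[m [m' [Dm Pm _]]]]]] := hx 0.
rewrite -Et in loop Et'.
have Ds : der [:: inr (S, [:: f0])] (term G x ++ inr (X, f :: rho0) :: term G y).
  by apply: der_trans Du0 _; apply: der_cat Dx (der_keep _ Dy).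
have Dz : der (hole rho0 Y) (term G (z1 ++ z2)).
  by apply: der_trans Dp0 _; rewrite /term map_cat; apply: der_cat.
have [H [g [u' [m1 [p' [q' [m2 [v' [HN gN someN D]]]]]]]]] :=
  pump_family (alpha 0) loop Du Dp (Q I) Dm (ty_productive Et' Pm) Ds Dz.
by apply: (morphic_pumped HN gN someN) => n; apply: pref; apply: D.
Qed.
End Pumping.

(** * The two inclusions *)

Lemma In_map (S T : Type) (f : S -> T) y s :
  List.In y (map f s) <-> exists x, List.In x s /\ y = f x.
Proof.
elim: s => [|x s IH] /=; first by split=> // -[? []].
rewrite IH; split=> [[<-|[z [zs ->]]]|[z [[->|zs] ->]]]; [by exists x; tauto|by exists z; tauto|by left|].
by right; exists z.
Qed.

Lemma In_mem (T : eqType) (x : T) s : List.In x s <-> x \in s.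
Proof.
elim: s => //= y s IH; rewrite inE IH.
by split=> [[->|->]|/orP[/eqP->|]]; rewrite ?eqxx ?orbT //; [left|right].
Qed.

(** Over a finite alphabet only finitely many words have length at most [K]. *)
Lemma unbounded_of_infinite (A : finType) (L : seq A -> Prop) :
  lang_infinite L -> forall K, exists w, K <= size w /\ L w.
Proof.
move=> inf K; apply: NNPP => none; apply: inf.
exists (map val (enum {bseq K of A})) => w Lw; apply/In_mem/mapP.
have le : size w <= K by rewrite leqNgt; apply/negP => /ltnW lt; apply: none; exists w.
by exists (Bseq le); rewrite ?mem_enum.
Qed.

Lemma infinite_of_unbounded (A : Type) (L : seq A -> Prop) :
  (forall K, exists w, K <= size w /\ L w) -> lang_infinite L.
Proof.
move=> unb [l P]; have [C PC] := bounded_list size l.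
by have [w [lt /P/PC]] := unb C.+1; rewrite leqNgt lt.
Qed.

(** * Adding a bottom marker to the stacks *)

Section BottomMarker.
Variables (A : finType) (G : indexed_grammar A).

Let mark_rhs (c : rhs_sym (ig_N G) (ig_F G) A) : rhs_sym (ig_N G) (option (ig_F G)) A :=
  match c with RTerm a => RTerm _ _ a | RNT Y psi => RNT _ Y (map Some psi) end.

(** No production pops the new flag [None]. Started on it, derivations never meet an empty stack, as
    [long_path] requires. *)
Definition marked : indexed_grammar A :=
  @IndexedGrammar A (ig_N G) (option (ig_F G)) (ig_start G)
    [seq (x.1, map mark_rhs x.2) | x <- ig_prods G]
    [seq (Some x.1.1, x.1.2, x.2) | x <- ig_flag_prods G].

Let mark (xi : seq (ig_F G)) : seq (ig_F marked) := rcons (map Some xi) None.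
Let mark1 (c : A + (ig_N G * seq (ig_F G))) : A + (ig_N marked * seq (ig_F marked)) :=
  match c with inl a => inl a | inr (X, xi) => inr (X, mark xi) end.

Let inst_mark xi rhs : map (@inst_prod A marked (mark xi)) (map mark_rhs rhs) =
  map mark1 (map (@inst_prod A G xi) rhs).
Proof.
rewrite -!map_comp; apply: eq_map => -[a|Y psi] //=.
by rewrite /mark -rcons_cat -map_cat.
Qed.

Let inst_flag_mark xi rhs : map (@inst_flag A marked (mark xi)) rhs =
  map mark1 (map (@inst_flag A G xi) rhs).
Proof. by rewrite -!map_comp; apply: eq_map => -[]. Qed.

Let edge_mark X xi s' : @edge A marked X (mark xi) s' <->
  exists s, s' = map mark1 s /\ @edge A G X xi s.
Proof.
split.
  case=> [[rhs [/In_map[[X' rhs0] [i [E1 E2]]] ->]]|].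
    rewrite /= in E1 E2; subst X' rhs; rewrite inst_mark.
    by eexists; split; first exact: erefl; left; exists rhs0.
  case=> f [xi' [rhs [E [/In_map[[[f0 X0] rhs0] [i [E1 E2 E3]]] ->]]]].
  rewrite /= in E1 E2 E3; subst f X0 rhs0.
  case: xi E => [|g xi] //= [Eg Exi]; subst g xi'.
  rewrite inst_flag_mark; eexists; split; first exact: erefl.
  by right; exists f0, xi, rhs.
case=> s [-> [[rhs [i ->]]|[f [xi' [rhs [-> [i ->]]]]]]].
  left; exists (map mark_rhs rhs); rewrite inst_mark; split=> //.
  by apply/In_map; exists (X, rhs).
right; exists (Some f), (mark xi'), rhs; rewrite inst_flag_mark; split=> //; split=> //.
by apply/In_map; exists (f, X, rhs).
Qed.

Let der_mark s t : @der A G s t -> @der A marked (map mark1 s) (map mark1 t).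
Proof.
elim=> [|c s' t' _ IH|X xi r s' t1 t2 E _ IH1 _ IH2]; first exact: der_nil.
  exact: der_keep.
by rewrite map_cat /=; apply: der_step IH1 IH2; apply/edge_mark; exists r.
Qed.

Let der_unmark s t' : @der A marked (map mark1 s) t' ->
  exists t, t' = map mark1 t /\ @der A G s t.
Proof.
move Es: (map mark1 s) => s' D.
elim: D s Es => {s' t'} [|c s' t' _ IH|X xi r s' t1 t2 E D1 IH1 _ IH2] [|d s] //=.
- by exists [::]; split=> //; apply: der_nil.
- case=> <- /IH[t [-> D]]; exists (d :: t); split=> //; exact: der_keep.
- case: d => // -[Y xi0] [-> Exi /IH2[t2' [-> D2]]].
  rewrite -Exi in E; have /edge_mark[r' [Er E']] := E.
  have [t1' [-> D1']] := IH1 _ (esym Er).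
  by exists (t1' ++ t2'); rewrite map_cat; split=> //; apply: der_step E' D1' D2.
Qed.

Lemma marked_lang w : ig_lang G w <->
  @der A marked [:: inr (ig_start marked, [:: None])] (term marked w).
Proof.
rewrite /ig_lang derivesE; split=> D.
  by have := der_mark D; rewrite -map_comp.
have [t [E Dt]] := @der_unmark [:: inr (ig_start G, [::])] _ D.
suff -> : map inl w = t by [].
elim: w t E {D Dt} => [|a w IH] [|c t] //= [Ec /IH ->].
by case: c Ec => [b [->]|[]].
Qed.
End BottomMarker.

Lemma morphic_of_indexed (A : finType) (G : indexed_grammar A) (alpha : nat -> A) :
  lang_infinite (ig_lang G) -> (forall w, ig_lang G w -> is_prefix w alpha) -> morphic alpha.
Proof.
move=> /unbounded_of_infinite inf pref.
apply: (@morphic_of_derivations A (marked G) (ig_start (marked G)) None).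
- by move=> X rhs /In_map[x [_]].
- by move=> K; have [w [le /marked_lang D]] := inf K; exists w.
- by move=> w /marked_lang/pref.
Qed.

(** * An indexed grammar for the words [e(h^n(a))] *)

Section MorphicIndexed.
Variables (A : finType) (alpha : nat -> A) (B : finType).
Variables (h : B -> seq B) (e : B -> A) (a : B).

Local Notation S0 := (None : option (option B)).
Local Notation S1 := (Some None : option (option B)).
Local Notation NTb b := (Some (Some b) : option (option B)).

(* The flag [true] applies h; the flag [false] marks the bottom and applies e. *)
Definition morphic_grammar : indexed_grammar A :=
  @IndexedGrammar A (option (option B)) bool S0
    [:: (S0, [:: RNT _ S1 [:: false]]); (S1, [:: RNT _ S1 [:: true]]); (S1, [:: RNT _ (NTb a) [::]])]
    ([seq (true, NTb b, map (fun c => inl (NTb c)) (h b)) | b <- enum B] ++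
     [seq (false, NTb b, [:: inr (e b)]) | b <- enum B]).
Local Notation G := morphic_grammar.

Let stk n : seq (ig_F G) := rcons (nseq n true) false.
Let word n := map e (iter n (morph_ext h) [:: a]).

Let flag_true b s : edge (G := G) (NTb b) (true :: s) (map (fun c => inr (NTb c, s)) (h b)).
Proof.
right; exists true, s, (map (fun c => inl (NTb c)) (h b)); split=> //; split; last by rewrite -map_comp.
apply/List.in_or_app; left; apply/In_map; exists b; split=> //.
by apply/In_mem; rewrite mem_enum.
Qed.

Let flag_false b s : edge (G := G) (NTb b) (false :: s) [:: inl (e b)].
Proof.
right; exists false, s, [:: inr (e b)]; split=> //; split=> //.
apply/List.in_or_app; right; apply/In_map; exists b; split=> //.
by apply/In_mem; rewrite mem_enum.
Qed.

Let der_letters n x : @der A G (map (fun c => inr (NTb c, stk n)) x)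
  (term G (map e (iter n (morph_ext h) x))).
Proof.
elim: n x => [|n IH] x.
  elim: x => [|b x IHx] /=; first exact: der_nil.
  exact: (der_cat (der_edge (flag_false b [::]) (der_refl _)) IHx).
rewrite iterSr; apply: der_trans (IH _); elim: x => [|b x IHx]; first exact: der_nil.
rewrite morph_extE subst_cons map_cat.
exact: (der_cat (der_edge (flag_true b (stk n)) (der_refl _)) IHx).
Qed.

Let lang_word n : ig_lang G (word n).
Proof.
apply/derivesE; apply: (@der_trans A G _ [:: inr (S1, stk 0)]).
  by apply: der_edge (der_refl _); left; eexists; split; first by left.
apply: (@der_trans A G _ [:: inr (S1, stk n)]).
  elim: n => [|n IH]; first exact: der_refl.
  apply: der_trans IH _; apply: der_edge (der_refl _); left.
  by exists [:: RNT _ S1 [:: true]]; split; first by right; left.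
apply: (@der_trans A G _ [:: inr (NTb a, stk n)]).
  by apply: der_edge (der_refl _); left; eexists; split; first by right; right; left.
exact: (der_letters n [:: a]).
Qed.

(** The terminal word that a symbol is bound to yield; [.-1] discounts the bottom flag. *)
Let val (c : A + (ig_N G * seq (ig_F G))) : seq A :=
  match c with
  | inl x => [:: x]
  | inr (Some (Some b), xi) => map e (iter (size xi).-1 (morph_ext h) [:: b])
  | _ => [::]
  end.
Let wf (c : A + (ig_N G * seq (ig_F G))) : bool :=
  match c with
  | inl x => true
  | inr (Some (Some b), xi) => xi == stk (size xi).-1
  | _ => false
  end.

Let wf_stk n s : true :: s = stk n -> exists m, n = m.+1 /\ s = stk m.
Proof. by case: n => [|n] //= [->]; exists n. Qed.

Let size_stk n : size (stk n) = n.+1.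
Proof. by rewrite size_rcons size_nseq. Qed.

Let val_letters n x : subst val (map (fun c => inr (NTb c, stk n)) x) =
  map e (iter n (morph_ext h) x).
Proof.
elim: x => [|b x IH]; first by rewrite iter_morph_nil.
by rewrite subst_cons IH -[in RHS]cat1s iter_morph_cat map_cat /= size_stk.
Qed.

(** The three cases are the phases of a derivation: start, pushing, popping. In the last phase no
    step changes [val], because popping [true] applies [h] and popping [false] applies [e]. *)
Let sound s : ig_derives [:: inr (ig_start G, [::])] s ->
  [\/ s = [:: inr (S0, [::])], exists n, s = [:: inr (S1, stk n)] |
      all wf s /\ exists n, subst val s = word n].
Proof.
move=> D; have {}D := clos_rt_rtn1 _ _ _ _ D.
elim: D => {s} [|s t /ig_stepE[pre [post [X [xi [r [Es E Et]]]]]] _ IH].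
  by constructor 1.
case: IH => [Es'|[n Es']|[ws [n vs]]].
- have [p0 q0 EX Exi] : [/\ pre = [::], post = [::], X = S0 & xi = [::]].
    by move: Es; rewrite Es'; case: (pre) => [|? [|? ?]] //= [-> -> <-].
  subst; constructor 2; exists 0; rewrite cats0.
  by case: E => [[rhs [[[<-]|[//|[//|[]]]] ->]]|[f [xi' [rhs []]]]].
- have [p0 q0 EX Exi] : [/\ pre = [::], post = [::], X = S1 & xi = stk n].
    by move: Es; rewrite Es'; case: (pre) => [|? [|? ?]] //= [-> -> <-].
  subst; rewrite cats0 /=.
  case: E => [[rhs [[//|[[<-]|[[<-]|[]]]] ->]]|[f [xi' [rhs [_ [i _]]]]]].
  + by constructor 2; exists n.+1.
  + constructor 3; split; first by rewrite /= size_stk eqxx.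
    by exists n; rewrite subst_seq1 /= size_stk.
  + by case: (List.in_app_or _ _ _ i) => /In_map[b [_]].
- constructor 3; subst s t; move: ws vs; rewrite !all_cat /= !subst_cat subst_cons.
  case/and3P => wpre wX wpost vs.
  case: X E wX vs => [[b|]|] // E /eqP Exi; rewrite [val _]/=.
  set n0 := (size xi).-1 in Exi *; move: n0 Exi => m Exi vs.
  suff [wr vr] : all wf r /\ subst val r = map e (iter m (morph_ext h) [:: b]).
    by rewrite wpre wr wpost; split=> //; exists n; rewrite vr.
  rewrite Exi in E; case: E => [[rhs [[//|[//|[//|[]]]] _]]|[f [xi' [rhs [Ef [i ->]]]]]].
  case: (List.in_app_or _ _ _ i) => /In_map[b' [_ [E1 E2 E3]]]; subst f b' rhs.
    have [m' [-> ->]] := wf_stk (esym Ef); rewrite -map_comp; split.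
      by rewrite all_map; apply/allP => c _ /=; rewrite size_stk eqxx.
    by rewrite iterSr morph_extE subst_seq1 -(val_letters m').
  by case: m Ef {vs Exi} => [|m] //.
Qed.

Hypothesis hP : prolongable h a.

Let word_size n : n <= size (iter n (morph_ext h) [:: a]).
Proof.
have [x [ha nm]] := hP; elim: n => // n IH.
rewrite iterSr morph_extE subst_seq1 ha -cat1s iter_morph_cat size_cat.
case E: (iter n (morph_ext h) x) => [|c s]; first by case: nm; exists n.
by rewrite /=; lia.
Qed.

Lemma morphic_indexed beta : is_h_omega h a beta -> (forall i, alpha i = e (beta i)) ->
  determines (ig_lang G) alpha.
Proof.
move=> hb Ea; split.
  apply: infinite_of_unbounded => K; exists (word K); split; last exact: lang_word.
  by rewrite size_map.
move=> w /sound[|[n]|[_ [n]]].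
- by case: w.
- by case: w.
- have -> : subst val (map inl w) = w by rewrite subst_map; apply: subst_pure.
  move=> -> i d; rewrite size_map => lt; rewrite Ea -(hb n i a lt).
  exact: nth_map.
Qed.
End MorphicIndexed.

Theorem theorem4 (A : finType) (alpha : nat -> A) :
  (exists L : seq A -> Prop, indexed_language L /\ determines L alpha) <->
  morphic alpha.
Proof.
split.
  case=> L [[G LG] [inf pref]]; apply: (@morphic_of_indexed A G).
    by case=> l P; apply: inf; exists l => w /LG/P.
  by move=> w /LG/pref.
case=> B [h [e [a [hP [beta [hb Ea]]]]]].
exists (ig_lang (morphic_grammar h e a)); split; first by exists (morphic_grammar h e a).
exact: (morphic_indexed hP hb Ea).
Qed.
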